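(* Let $1<p<\infty$, let $\Omega\subset\mathbb{R}^n$ be a bounded domain, and let $\mu$, $Q$, $v$ be as in the context. Let $\rho$ be a quasimetric on $\Omega$ satisfying the standing conditions of the context and such that $(\Omega,\rho)$ is locally geometrically doubling. Suppose that $(\Omega,\rho)$ supports a local Poincar\'e property of order $p$. Then: (a) $QH^{1,p}(v,\mu;\Omega)$ is compactly embedded in $L^q_v(\mu;\Omega)$ for every $1\le q<p$, through $(u,\nabla u)\mapsto u$; (b) for every $E\Subset\Omega$, $QH^{1,p}(v,\mu;\Omega)$ is compactly embedded in $L^q_v(\mu;E)$ for every $1\le q\le p$, through $(u,\nabla u)\mapsto u|_E$. Here a normed space $X$ is compactly embedded in a normed space $Y$ through a map $\pi:X\to Y$ if for every bounded sequence in $X$ the image sequence under $\pi$ has a subsequence converging in $Y$ (in particular the indicated map takes values in $Y$).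
   Context: Setting. $\Omega\subset\mathbb{R}^n$ is a bounded, open, connected set; $\mu$ is a regular measure on $\Omega$, absolutely continuous with respect to Lebesgue measure. $Q$ is a $\mu$-measurable function on $\Omega$ with values in the non-negative definite self-adjoint (real symmetric) $n\times n$ matrices, and $\sqrt{Q(x)}$ is the non-negative definite square root. Put $v_0(x)=\|Q(x)\|_{\mathrm{op}}^{p/2}$, where $\|Q(x)\|_{\mathrm{op}}=\sup_{|\xi|=1}|Q(x)\xi|$. It is assumed that $\sqrt Q\in L^p(\mu;\Omega)$. $v$ is a weight on $\Omega$ (a nonnegative function locally integrable with respect to $\mu$) for which there is $c_2>0$ with $v_0(x)\le c_2v(x)$ for $x\in\Omega$. Write $v(B)=\int_B v\,d\mu$, and let $L^q_v(\mu;E)$ be the space with norm $\|f\|_{L^q_v(\mu;E)}=(\int_E|f|^qv\,d\mu)^{1/q}$. $E\Subset\Omega$ means that the closure of $E$ is a compact subset of $\Omega$ (sets $E$ are measurable). Sobolev space. For a locally Lipschitz function $f$ and a measurable set $A\subset\Omega$ let $$\|(f,\nabla f)\|_{QH^{1,p}(v,\mu;A)}=\Big(\int_A|f|^pv\,d\mu\Big)^{1/p}+\Big(\int_A|\sqrt Q\,\nabla f|^p\,d\mu\Big)^{1/p}.$$ $Lip_Q(\Omega)$ is the set of locally Lipschitz $f$ on $\Omega$ for which this norm with $A=\Omega$ is finite. $\mathcal L^p_Q(\mu;\Omega)$ is the space of $\mu$-measurable vector fields $\vec k$ with $\|\vec k\|_{\mathcal L^p_Q(\mu;\Omega)}=(\int_\Omega|\sqrt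 Q\,\vec k|^pd\mu)^{1/p}<\infty$ (modulo fields of zero norm). $QH^{1,p}(v,\mu;\Omega)$ is the completion of $Lip_Q(\Omega)$ with respect to $\|\cdot\|_{QH^{1,p}(v,\mu;\Omega)}$, identified with the closure of $\{(f,\nabla f):f\in Lip_Q(\Omega)\}$ in $L^p_v(\mu;\Omega)\times\mathcal L^p_Q(\mu;\Omega)$; its elements are written as pairs $(u,\nabla u)$, where the second component $\nabla u$ denotes the $\mathcal L^p_Q$-limit of gradients of an approximating sequence. Quasimetric. $\rho$ is a quasimetric on $\Omega$: for some $\kappa\ge1$ and all $x,y,z\in\Omega$, $\rho(x,y)\ge0$ with equality only if $x=y$, $\rho(x,y)=\rho(y,x)$, and $\rho(x,y)\le\kappa(\rho(x,z)+\rho(z,y))$. $B(x,r)=\{y\in\Omega:\rho(x,y)<r\}$. Standing conditions: all $\rho$-balls are open (in the Euclidean topology), and for every $x\in\Omega$ there is $\delta(x)>0$ with $\overline{B(x,r)}\subset\Omega$ for $0<r<\delta(x)$. Locally geometrically doubling: there is a function $C:(0,\infty)\to(0,\infty)$ such that for every compact $K\subset\Omega$ there is $\delta>0$ such that whenever $0<s\le r<\delta$ and $x\in K$, the ball $B(x,r)$ contains at most $C(r/s)$ centers of disjoint $\rho$-balls of radius $s$ ($C$ is independent of $K$). Local Poincar\'e property of order $p$: there is $c_0\ge1$ such that for every compact $K\subset\Omega$ and $\epsilon>0$ there is $\delta_1>0$ such that for $0<r<\delta_1$ and $x\in K$, $$\|f-f_{B(x,r)}\|_{L^p_v(\mu;B(x,r))}\le\epsilon\,\|(f,\nabla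 f)\|_{QH^{1,p}(v,\mu;B(x,c_0r))}$$ for every locally Lipschitz $f$ on $\Omega$, where $f_B=\frac1{v(B)}\int_Bfv\,d\mu$.
   Formalization: In (a) the hypothesis that v(Ω) is finite is added; without it (a) fails, e.g. Ω=(0,1), μ Lebesgue, Q=1, v=x^{-3}, p=2, q=1, where f=x^2 lies in Lip_Q(Ω) but not in L^1_v(Ω). Part (b) is unchanged. *)

(* Defs.v *)
From HB Require Import structures.
From mathcomp Require Import all_boot all_order all_algebra.
From mathcomp Require Import all_classical all_reals all_analysis.
Set Implicit Arguments.
Unset Strict Implicit.
Unset Printing Implicit Defensive.
Import Order.TTheory GRing.Theory Num.Theory.
Import numFieldNormedType.Exports.
Local Open Scope classical_set_scope.
Local Open Scope ring_scope.

(* The library norm on ['cV[R]_n] is the sup norm; it is used only through the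
   topology, boundedness and local Lipschitz continuity, where it is
   interchangeable with [enorm]. *)
Section LinearAlgebra.
Variables (R : realType) (n : nat).
Implicit Types (A S : 'M[R]_n) (xi : 'cV[R]_n).

Definition enorm xi : R := Num.sqrt (\sum_i xi i ord0 ^+ 2).

Definition opnorm A : R :=
  sup [set enorm (A *m xi) | xi in [set xi : 'cV[R]_n | enorm xi = 1]].

Definition psdmx A : Prop :=
  A^T = A /\ forall xi, 0 <= (xi^T *m A *m xi) ord0 ord0.

(* A nonnegative definite [A] has exactly one nonnegative definite square
   root; [sqrtmx A] is [0] when there is none. *)
Definition sqrtmx A : 'M[R]_n :=
  xget 0 [set S : 'M[R]_n | psdmx S /\ S *m S = A].

End LinearAlgebra.

Section LebesgueOuterMeasure.
Variables (R : realType) (n : nat).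

Definition box (a b : 'cV[R]_n) : set 'cV[R]_n :=
  [set x | forall i, a i ord0 <= x i ord0 < b i ord0].

Definition box_volume (a b : 'cV[R]_n) : R :=
  \prod_i Num.max 0 (b i ord0 - a i ord0).

Definition lebesgue_outer (A : set 'cV[R]_n) : \bar R :=
  ereal_inf [set (\sum_(0 <= k <oo) (box_volume (ab k).1 (ab k).2)%:E)%E
    | ab in [set ab : nat -> 'cV[R]_n * 'cV[R]_n |
              A `<=` \bigcup_k box (ab k).1 (ab k).2]].

End LebesgueOuterMeasure.

Section Calculus.
Variables (R : realType) (n : nat) (Omega : set 'cV[R]_n).

Definition loc_lipschitz (f : 'cV[R]_n -> R) : Prop :=
  forall x, Omega x -> exists2 U, nbhs x U & [lipschitz f y | y in U].

(* At the points where [f] is not differentiable, the value is arbitrary; for a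
   locally Lipschitz [f] they form a Lebesgue null set. *)
Definition grad (f : 'cV[R]_n -> R) (x : 'cV[R]_n) : 'cV[R]_n :=
  \col_i 'D_(delta_mx i ord0) f x.

Definition compactly_contained (E : set 'cV[R]_n) : Prop :=
  compact (closure E) /\ closure E `<=` Omega.

End Calculus.

Section Quasimetric.
Variables (R : realType) (n : nat) (Omega : set 'cV[R]_n).
Variable rho : 'cV[R]_n -> 'cV[R]_n -> R.

Definition is_quasimetric : Prop :=
  exists2 kappa : R, 1 <= kappa &
  forall x y z, Omega x -> Omega y -> Omega z ->
  [/\ 0 <= rho x y, rho x y = 0 <-> x = y, rho x y = rho y x &
      rho x y <= kappa * (rho x z + rho z y)].

Definition qball (x : 'cV[R]_n) (r : R) : set 'cV[R]_n :=
  [set y | Omega y /\ rho x y < r].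

Definition qballs_open : Prop :=
  forall x r, Omega x -> open (qball x r).

Definition qballs_interior : Prop :=
  forall x, Omega x -> exists2 delta : R, 0 < delta &
    forall r, 0 < r < delta -> closure (qball x r) `<=` Omega.

Definition locally_geometrically_doubling : Prop :=
  exists2 C : R -> R, (forall t, 0 < t -> 0 < C t) &
  forall K, compact K -> K `<=` Omega ->
  exists2 delta : R, 0 < delta &
  forall s r x, 0 < s -> s <= r -> r < delta -> K x ->
  forall (m : nat) (c : 'I_m -> 'cV[R]_n),
    (forall i, qball x r (c i)) ->
    trivIset setT (fun i => qball (c i) s) ->
    m%:R <= C (r / s).

End Quasimetric.

(* Points of the spaces below are functions, not classes modulo null functions,
   and norms are extended-real seminorms. A seminormed space is given by its set
   of elements and its seminorm; the second clause states that [pi] is well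
   defined on classes of elements at distance zero. *)
Definition compactly_embedded (R : realType) (X Y : zmodType)
    (SX : set X) (NX : X -> \bar R) (SY : set Y) (NY : Y -> \bar R)
    (pi : X -> Y) : Prop :=
  [/\ forall x, SX x -> SY (pi x),
      forall x y, SX x -> SX y -> NX (x - y) = 0%E -> NY (pi x - pi y) = 0%E &
      forall u : nat -> X, (forall k, SX (u k)) ->
        (exists C : R, forall k, (NX (u k) <= C%:E)%E) ->
        exists2 s : nat -> nat, increasing_seq s &
        exists2 y, SY y & NY (pi (u (s k)) - y) @[k --> \oo] --> 0%E].

Section MeasureOnOmega.
(* [M] is the sigma-algebra of mu-measurable sets: any sigma-algebra containing
   the Borel sets, so that [mu] may be a Borel measure or a completion. A
   measure on [Omega] is given by a measure on R^n, of which only the values on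
   subsets of [Omega] are used. *)
Variables (R : realType) (n : nat) (M : set (set 'cV[R]_n)).
Notation T := (g_sigma_algebraType M).
Variable mu : {measure set T -> \bar R}.
Variable Omega : set 'cV[R]_n.

Definition borel_sigma_algebra_ext : Prop :=
  sigma_algebra setT M /\ open `<=` M.

Definition regular_measure : Prop :=
  forall A : set 'cV[R]_n, M A -> A `<=` Omega ->
    mu A = ereal_inf [set mu U | U in [set U : set 'cV[R]_n |
             [/\ open U, A `<=` U & U `<=` Omega]]] /\
    mu A = ereal_sup [set mu K | K in [set K : set 'cV[R]_n |
             compact K /\ K `<=` A]].

Definition lebesgue_abs_continuous : Prop :=
  forall A : set 'cV[R]_n, M A -> A `<=` Omega ->
    lebesgue_outer A = 0%E -> mu A = 0%E.

Definition mu_measurable (A : set 'cV[R]_n) (f : 'cV[R]_n -> R) : Prop :=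
  measurable_fun (A : set T) (f : T -> R).

Definition mu_measurable_vec (A : set 'cV[R]_n) (w : 'cV[R]_n -> 'cV[R]_n) :=
  forall i, mu_measurable A (fun x => w x i ord0).

Definition mu_measurable_mx (A : set 'cV[R]_n) (Q : 'cV[R]_n -> 'M[R]_n) :=
  forall i j, mu_measurable A (fun x => Q x i j).

Definition Lp_matrix (p : R) (S : 'cV[R]_n -> 'M[R]_n) : Prop :=
  mu_measurable_mx Omega S /\
  (\int[mu]_(x in Omega) (opnorm (S x) `^ p)%:E < +oo)%E.

Definition is_weight (v : 'cV[R]_n -> R) : Prop :=
  [/\ mu_measurable Omega v,
      forall x, Omega x -> 0 <= v x &
      forall K : set 'cV[R]_n, compact K -> K `<=` Omega ->
        (\int[mu]_(x in K) (v x)%:E < +oo)%E].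

Definition Lnormw (q : R) (v : 'cV[R]_n -> R) (A : set 'cV[R]_n)
    (f : 'cV[R]_n -> R) : \bar R :=
  ((\int[mu]_(x in A) (`|f x| `^ q * v x)%:E) `^ q^-1)%E.

Definition Lspacew (q : R) (v : 'cV[R]_n -> R) (A : set 'cV[R]_n) :
    set ('cV[R]_n -> R) :=
  [set f | mu_measurable A f /\ (Lnormw q v A f < +oo)%E].

Definition LnormQ (p : R) (Q : 'cV[R]_n -> 'M[R]_n) (A : set 'cV[R]_n)
    (w : 'cV[R]_n -> 'cV[R]_n) : \bar R :=
  ((\int[mu]_(x in A) (enorm (sqrtmx (Q x) *m w x) `^ p)%:E) `^ p^-1)%E.

Definition LspaceQ (p : R) (Q : 'cV[R]_n -> 'M[R]_n) (A : set 'cV[R]_n) :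
    set ('cV[R]_n -> 'cV[R]_n) :=
  [set w | mu_measurable_vec A w /\ (LnormQ p Q A w < +oo)%E].

Definition QHnorm (p : R) (v : 'cV[R]_n -> R) (Q : 'cV[R]_n -> 'M[R]_n)
    (A : set 'cV[R]_n)
    (z : ('cV[R]_n -> R) * ('cV[R]_n -> 'cV[R]_n)) : \bar R :=
  (Lnormw p v A z.1 + LnormQ p Q A z.2)%E.

Definition LipQ (p : R) (v : 'cV[R]_n -> R) (Q : 'cV[R]_n -> 'M[R]_n) :
    set ('cV[R]_n -> R) :=
  [set f | loc_lipschitz Omega f /\ (QHnorm p v Q Omega (f, grad f) < +oo)%E].

Definition QH (p : R) (v : 'cV[R]_n -> R) (Q : 'cV[R]_n -> 'M[R]_n) :
    set (('cV[R]_n -> R) * ('cV[R]_n -> 'cV[R]_n)) :=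
  [set z | [/\ Lspacew p v Omega z.1, LspaceQ p Q Omega z.2 &
    exists2 f : nat -> 'cV[R]_n -> R, (forall k, LipQ p v Q (f k)) &
      QHnorm p v Q Omega (z - (f k, grad (f k))) @[k --> \oo] --> 0%E]].

(* Equal to [0] when [v B = 0]. *)
Definition wavg (v : 'cV[R]_n -> R) (B : set 'cV[R]_n)
    (f : 'cV[R]_n -> R) : R :=
  (\int[mu]_(x in B) v x)^-1 * \int[mu]_(x in B) (f x * v x).

Definition local_poincare (p : R) (v : 'cV[R]_n -> R)
    (Q : 'cV[R]_n -> 'M[R]_n) (rho : 'cV[R]_n -> 'cV[R]_n -> R) : Prop :=
  exists2 c0 : R, 1 <= c0 &
  forall (K : set 'cV[R]_n) (eps : R), compact K -> K `<=` Omega -> 0 < eps ->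
  exists2 delta1 : R, 0 < delta1 &
  forall r x, 0 < r < delta1 -> K x ->
  forall f, loc_lipschitz Omega f ->
    let B := qball Omega rho x r in
    (Lnormw p v B (fun y => f y - wavg v B f)%R <=
     eps%:E * QHnorm p v Q (qball Omega rho x (c0 * r)) (f, grad f))%E.

End MeasureOnOmega.

(* Main.v *)
Require Import Defs.
From mathcomp Require Import all_boot all_order all_algebra.
From mathcomp Require Import all_classical all_reals all_analysis.
From mathcomp Require Import measurable_realfun lra ring.

(** The theorem is a Rellich-Kondrachov argument driven by a Poincare inequality on small balls.

Let [(u_k)] be bounded in [QH]. Each [u_k] is as close as desired, in the norm of [QH], to a locally
Lipschitz [f_k], so consider a bounded sequence of such functions and a compact [K]. For a small
radius, [K] is covered by finitely many balls [B_l] centred at a separated net of [K]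
([quasimetric_net]). Doubling bounds the overlap of the enlarged balls by a number [N] that depends
neither on the radius nor on the net ([net_overlap]). Hence summing the Poincare inequality over
the net bounds [sum_l int_(B_l) |f_k - a_(k,l)|^p v], where [a_(k,l)] is the average of [f_k] on
[B_l], by [eta^p N] times a constant, with [eta] as small as desired. For each of the finitely many
[l], the averages [a_(k,l)] form a bounded sequence of reals, which converges after extraction. So,
up to an arbitrarily small error in [L^p], the restriction of [f_k] to [K] is determined by finitely
many bounded numbers ([lipschitz_ultra_cauchy], [QH_ultra_cauchy]). The Poincare inequality
is applied to each [f_k], never to a difference, so the gradient of a difference does not appear.

Extractions are made once and for all by a free ultrafilter [U] on the indices: bounded real
sequences converge along [U], and being Cauchy along [U] ([ultra_cauchy]) can be tested
one error bound and one compact set at a time. Only at the end does it yield a genuine subsequence,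
whose limit comes from the completeness of the weighted spaces ([wint_complete],
[ultra_cauchy_cvg]).

To pass from [L^p] to [L^q], and in part (a) from compact sets to the whole domain, the elementary
inequality [t^q <= l^q + l^(q-p) t^p] ([powR_interpolation]) is used with a free parameter [l]: for
small [l] it shows that smallness in [L^p] implies smallness in [L^q] on a set of finite weight
([wint_small]), and for large [l] that a bounded sequence of [L^p] has uniformly small [L^q] tails
when [q < p] ([ultra_cauchy_exhaustion]).

Norms enter through their [p]-th powers, which are additive in the domain of integration, and
constants are irrelevant for compactness; this is why the quasi-triangle inequality with
constant [2^p] takes the place of Minkowski's inequality. *)

Set Implicit Arguments.
Unset Strict Implicit.
Unset Printing Implicit Defensive.
Import Order.TTheory GRing.Theory Num.Theory.
Import numFieldNormedType.Exports.
Local Open Scope classical_set_scope.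
Local Open Scope ring_scope.

(** * Lower integrals of nonnegative functions *)

Section LowerIntegral.
Context d (T : measurableType d) (R : realType).
Variable mu : {measure set T -> \bar R}.
Local Open Scope ereal_scope.
Import HBNNSimple.
Implicit Types (f g h : T -> \bar R) (A D : set T).

(** The integral of a nonnegative function that may fail to be measurable is the supremum
of the integrals of the simple functions below it. The integrand [|sqrt Q grad f|^p] is treated as
such a function; the lemmas below are the rules of integration that remain available. *)
Lemma le_lower_integral D f g : (forall x, D x -> 0 <= f x) ->
  (forall x, D x -> f x <= g x) ->
  \int[mu]_(x in D) f x <= \int[mu]_(x in D) g x.
Proof.
move=> f0 fg; have g0 x : D x -> 0 <= g x by move=> Dx; apply: le_trans (fg _ Dx); exact: f0.
rewrite !ge0_integralE//; apply: le_ereal_sup => _ [h hf <-]; exists h => // x.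
apply: le_trans (hf x) _; rewrite /patch; case: ifPn => // /set_mem; exact: fg.
Qed.

Lemma le_lower_integral_set A D f : A `<=` D -> (forall x, D x -> 0 <= f x) ->
  \int[mu]_(x in A) f x <= \int[mu]_(x in D) f x.
Proof.
move=> AD f0; rewrite integral_mkcond [leRHS]integral_mkcond.
apply: le_lower_integral => x _.
  by apply: erestrict_ge0 => y /AD; exact: f0.
rewrite /patch; case: ifPn => [/set_mem/AD/mem_set ->//|_].
by case: ifPn => // /set_mem; exact: f0.
Qed.

Lemma lower_integral_le D f (c : \bar R) : (forall x, D x -> 0 <= f x) ->
  (forall h : {nnsfun T >-> R}, (forall x, (h x)%:E <= (f \_ D) x) ->
     \int[mu]_x (h x)%:E <= c) ->
  \int[mu]_(x in D) f x <= c.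
Proof.
move=> f0 hc; rewrite ge0_integralE//; apply: ge_ereal_sup => _ [h hf <-].
by rewrite -integralT_nnsfun; exact: hc.
Qed.

Lemma lower_integral_ge (D : set T) f (h : {nnsfun T >-> R}) :
  (forall x, D x -> 0 <= f x) ->
  (forall x, (h x)%:E <= (f \_ D) x) ->
  \int[mu]_x (h x)%:E <= \int[mu]_(x in D) f x.
Proof.
move=> f0 hf; rewrite (integral_mkcond D); apply: le_lower_integral => x _ //.
by rewrite lee_fin.
Qed.

(** Simple functions below [f] and below [g] add up to a simple function below
[f + g]. *)
Lemma lower_integralD_ge D f g : (forall x, D x -> 0 <= f x) ->
  (forall x, D x -> 0 <= g x) ->
  \int[mu]_(x in D) f x + \int[mu]_(x in D) g x <= \int[mu]_(x in D) (f x + g x).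
Proof.
move=> f0 g0.
have fg0 x : D x -> 0 <= f x + g x by move=> Dx; rewrite adde_ge0 ?f0 ?g0.
have [/eqP fgy|] := eqVneq (\int[mu]_(x in D) (f x + g x)) +oo.
  by move: fgy => /eqP ->; rewrite leey.
rewrite -ltey => fgy.
have If : \int[mu]_(x in D) f x \is a fin_num.
  rewrite ge0_fin_numE ?integral_ge0//; apply: le_lt_trans fgy.
  by apply: le_lower_integral => // x Dx; rewrite leeDl// g0.
have Ig : \int[mu]_(x in D) g x \is a fin_num.
  rewrite ge0_fin_numE ?integral_ge0//; apply: le_lt_trans fgy.
  by apply: le_lower_integral => // x Dx; rewrite leeDr// f0.
rewrite -leeBrDr//; apply: lower_integral_le => // h1 h1f.
have h1fin : \int[mu]_x (h1 x)%:E \is a fin_num.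
  rewrite ge0_fin_numE; last by apply: integral_ge0 => x _; rewrite lee_fin.
  apply: le_lt_trans (lower_integral_ge f0 h1f) _.
  by rewrite -ge0_fin_numE// integral_ge0.
rewrite leeBrDr// addeC -leeBrDr//; apply: lower_integral_le => // h2 h2g.
rewrite leeBrDr// -ge0_integralD//; last 4 first.
- by move=> x _; rewrite lee_fin.
- by apply/measurable_EFinP; exact: measurable_funTS.
- by move=> x _; rewrite lee_fin.
- by apply/measurable_EFinP; exact: measurable_funTS.
rewrite (_ : (fun x => _) = fun x => (add_nnsfun h2 h1 x)%:E)//.
apply: lower_integral_ge => // x; rewrite /= EFinD addeC.
have := leeD (h1f x) (h2g x); rewrite /patch; case: ifP => //.
by rewrite adde0.
Qed.

Lemma lower_integral_sum_ge I (s : seq I) (P : pred I) D (f : I -> T -> \bar R) :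
  (forall i x, D x -> 0 <= f i x) ->
  \sum_(i <- s | P i) \int[mu]_(x in D) f i x <= \int[mu]_(x in D) \sum_(i <- s | P i) f i x.
Proof.
move=> f0; elim: s => [|i s IH].
  by rewrite big_nil; under eq_integral do rewrite big_nil; rewrite integral0.
under eq_integral do rewrite big_cons.
rewrite big_cons; case: ifP => // Pi.
apply: le_trans (leeD2l _ IH) _; apply: lower_integralD_ge => x Dx; first exact: f0.
by apply: sume_ge0 => j _; exact: f0.
Qed.

Lemma lower_integralZ_le (D : set T) f (k : R) : (0 < k)%R ->
  (forall x, D x -> 0 <= f x) ->
  \int[mu]_(x in D) (k%:E * f x) <= k%:E * \int[mu]_(x in D) f x.
Proof.
move=> k0 f0; apply: lower_integral_le => [x Dx|h hf].
  by rewrite mule_ge0 ?f0// lee_fin ltW.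
have kV0 : (0 <= k^-1)%R by rewrite invr_ge0 ltW.
have /(lower_integral_ge f0) : forall x, (scale_nnsfun h kV0 x)%:E <= (f \_ D) x.
  move=> x; have := hf x; rewrite /patch/=; case: ifP => _.
    by rewrite EFinM lee_pdivrMl.
  by rewrite !lee_fin => h0; rewrite pmulr_rle0 ?invr_gt0.
rewrite -(lee_pmul2l (x := k%:E))// => /(le_trans _); apply.
rewrite -ge0_integralZl_EFin//; last 3 first.
- by move=> x _; rewrite lee_fin.
- by apply/measurable_EFinP; exact: measurable_funTS.
- exact: ltW.
by apply: le_lower_integral => x _; rewrite lee_fin//= mulrA divff ?gt_eqF// mul1r.
Qed.

(** If a simple function [h] lies below [g + k], the positive part of [h - g] is
measurable and lies below [k]. The measurability of [g] is what makes the inequality go this way. *)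
Lemma lower_integralD_le D f g k : measurable D -> (forall x, D x -> 0 <= f x) ->
  (forall x, D x -> 0 <= g x) -> measurable_fun D g -> (forall x, D x -> 0 <= k x) ->
  (forall x, D x -> f x <= g x + k x) ->
  \int[mu]_(x in D) f x <= \int[mu]_(x in D) g x + \int[mu]_(x in D) k x.
Proof.
move=> mD f0 g0 mg k0 fgk; apply: lower_integral_le => // h hf.
have mh : measurable_fun D (EFin \o h).
  by apply/measurable_EFinP; exact: measurable_funTS.
have -> : \int[mu]_x (h x)%:E = \int[mu]_(x in D) (h x)%:E.
  rewrite [RHS]integral_mkcond; apply: eq_integral => x _; rewrite /patch.
  case: ifPn => // xD; have := hf x; rewrite /patch (negbTE xD) => hx.
  by apply/eqP; rewrite eq_le hx lee_fin/=.
have mm : measurable_fun D (fun x => maxe 0 ((h x)%:E - g x)).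
  by apply: measurable_maxe => //; exact: emeasurable_funB.
apply: (@le_trans _ _ (\int[mu]_(x in D) (g x + maxe 0 ((h x)%:E - g x)))).
  apply: le_lower_integral => [x _|x Dx]; first by rewrite lee_fin.
  have := g0 _ Dx; case: (g x) => [r| |]//= r0.
    by rewrite -leeBlDl// le_max lexx orbT.
  by rewrite addye ?leey// -ltNye; apply: lt_le_trans (_ : 0 <= _); rewrite ?le_max ?lexx.
rewrite ge0_integralD//; last by move=> x _; rewrite le_max lexx.
apply: leeD2l; apply: le_lower_integral => x Dx; first by rewrite le_max lexx.
rewrite ge_max k0//=; have := hf x; rewrite /patch mem_set// => hfx.
have := le_trans hfx (fgk _ Dx); have := g0 _ Dx; case: (g x) => [r| |]//= r0.
  by move=> hgk; rewrite EFinN leeBlDl.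
by rewrite leNye.
Qed.

End LowerIntegral.

(** * Integrals of weighted powers *)

Section PowR.
Variable R : realType.
Implicit Types (x y p q : R).

Lemma powR_max_le x y p : 0 <= p -> 0 <= x -> 0 <= y ->
  Num.max x y `^ p <= x `^ p + y `^ p.
Proof.
move=> p0 x0 y0; rewrite maxEle; case: ifP => _.
  by rewrite lerDr powR_ge0.
by rewrite lerDl powR_ge0.
Qed.

(** The substitute for Minkowski's inequality. *)
Lemma powRD_le x y p : 0 <= p -> 0 <= x -> 0 <= y ->
  (x + y) `^ p <= 2 `^ p * (x `^ p + y `^ p).
Proof.
move=> p0 x0 y0; apply: (@le_trans _ _ ((2 * Num.max x y) `^ p)).
  apply: ge0_ler_powR; rewrite ?nnegrE ?addr_ge0 ?mulr_ge0 ?le_max ?x0//.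
  rewrite mulrDl mul1r lerD// le_max lexx ?orbT//.
by rewrite powRM ?le_max ?x0// ler_wpM2l ?powR_ge0 ?powR_max_le.
Qed.

(** The substitute for Hoelder's inequality: the first term is enough where
[x <= l], the second one where [x > l]. *)
Lemma powR_interpolation x q p (l : R) : 0 <= x -> 0 < q -> q <= p -> 0 < l ->
  x `^ q <= l `^ q + l `^ (q - p) * x `^ p.
Proof.
move=> x0 q0 qp l0; have [xl|lx] := leP x l.
  apply: (@le_trans _ _ (l `^ q)); last by rewrite lerDl mulr_ge0 ?powR_ge0.
  by apply: ge0_ler_powR; rewrite ?nnegrE//; exact: ltW.
have xgt0 : 0 < x := lt_trans l0 lx.
have -> : x `^ p = x `^ (p - q) * x `^ q.
  by rewrite -powRD ?subrK// (gt_eqF xgt0) implybT.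
apply: (@le_trans _ _ (l `^ (q - p) * x `^ (p - q) * x `^ q)); last first.
  by rewrite -mulrA lerDr powR_ge0.
rewrite ler_peMl ?powR_ge0// -[q - p]opprB powRN mulrC ler_pdivlMr ?powR_gt0//.
by rewrite mul1r ge0_ler_powR ?nnegrE ?subr_ge0// ltW.
Qed.

Lemma cvg_powR (u : R^nat) l p : 0 < p -> (forall k, 0 <= u k) ->
  u k @[k --> \oo] --> l -> u k `^ p @[k --> \oo] --> l `^ p.
Proof.
move=> p0 u0 ul.
have l0 : 0 <= l.
  by rewrite -(cvg_lim (@Rhausdorff R) ul); apply: limr_ge; [exact: cvgP ul|exact: nearW].
move: l0; rewrite le_eqVlt => /predU1P[l0|l0]; last first.
  refine (@continuous_cvg nat R R \oo _ u (fun a : R => a `^ p) l _ ul).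
  apply/differentiable_continuous/derivable1_diffP/derivable_powR.
  by rewrite in_itv/= l0.
move: ul; rewrite -l0 powR0 ?gt_eqF// => /cvgrPdist_lt ul.
apply/cvgrPdist_lt => e e0; have := ul (e `^ p^-1) (powR_gt0 _ e0).
apply: filterS => k; rewrite !sub0r !normrN !ger0_norm ?powR_ge0// => uke.
have := @gt0_ltr_powR _ p p0 (u k) (e `^ p^-1).
rewrite !nnegrE u0 powR_ge0 => /(_ isT isT uke).
by rewrite -powRrM mulVf ?gt_eqF// powRr1 ?ltW.
Qed.

End PowR.

(** The [p]-th power of [Lnormw], over an arbitrary measurable space. *)
Definition wint d (T : measurableType d) (R : realType)
    (mu : {measure set T -> \bar R}) (v : T -> R) (p : R) (A : set T) (f : T -> R) : \bar R :=
  (\int[mu]_(x in A) (`|f x| `^ p * v x)%:E)%E.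

Section Weighted.
Context d (T : measurableType d) (R : realType).
Variables (mu : {measure set T -> \bar R}) (v : T -> R).
Local Open Scope ereal_scope.
Implicit Types (A : set T) (f g u : T -> R) (p q : R).

Lemma wint_ge0 p A f : (forall x, A x -> (0 <= v x)%R) -> 0 <= wint mu v p A f.
Proof.
by move=> v0; apply: integral_ge0 => x Ax; rewrite lee_fin mulr_ge0 ?powR_ge0 ?v0.
Qed.

Lemma measurable_wint p A f : measurable_fun A v -> measurable_fun A f ->
  measurable_fun A (fun x => (`|f x| `^ p * v x)%:E).
Proof.
move=> mv mf; apply/measurable_EFinP; apply: measurable_funM => //.
by apply: (measurableT_comp (measurable_powR p)); exact: measurableT_comp.
Qed.

Lemma eq_wint p A f g : (forall x, A x -> f x = g x) ->
  wint mu v p A f = wint mu v p A g.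
Proof. by move=> fg; apply: eq_integral => x /set_mem Ax; rewrite fg. Qed.

Lemma wintN p A f : wint mu v p A (fun x => - f x)%R = wint mu v p A f.
Proof. by apply: eq_integral => x _; rewrite normrN. Qed.

Lemma wintC p A f g :
  wint mu v p A (fun x => f x - g x)%R = wint mu v p A (fun x => g x - f x)%R.
Proof. by apply: eq_integral => x _; rewrite distrC. Qed.

Lemma wint_subset p A D f : (forall x, D x -> (0 <= v x)%R) -> A `<=` D ->
  wint mu v p A f <= wint mu v p D f.
Proof.
move=> v0 AD; apply: le_lower_integral_set => // x Dx.
by rewrite lee_fin mulr_ge0 ?powR_ge0 ?v0.
Qed.

Lemma wintD_le p A f g : measurable A -> (0 <= p)%R ->
  measurable_fun A v -> (forall x, A x -> (0 <= v x)%R) ->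
  measurable_fun A f -> measurable_fun A g ->
  wint mu v p A (fun x => f x + g x)%R <=
    (2 `^ p)%:E * (wint mu v p A f + wint mu v p A g).
Proof.
move=> mA p0 mv v0 mf mg.
have t0 (h : T -> R) x : A x -> 0 <= (`|h x| `^ p * v x)%:E.
  by move=> Ax; rewrite lee_fin mulr_ge0 ?powR_ge0 ?v0.
rewrite /wint -ge0_integralD//;
  [|exact: t0|exact: measurable_wint|exact: t0|exact: measurable_wint].
rewrite -ge0_integralZl_EFin// ?powR_ge0//; last 2 first.
- by move=> x Ax; rewrite adde_ge0 ?t0.
- by apply: emeasurable_funD; exact: measurable_wint.
apply: le_lower_integral => x Ax; first by rewrite lee_fin mulr_ge0 ?powR_ge0 ?v0.
rewrite -EFinD -EFinM lee_fin -mulrDl mulrA ler_wpM2r ?v0//.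
apply: le_trans (powRD_le p0 _ _) => //.
by apply: ge0_ler_powR; rewrite ?nnegrE ?addr_ge0// ler_normD.
Qed.

Lemma wint_interpolation p q A f (l : R) : measurable A ->
  (0 < q)%R -> (q <= p)%R -> (0 < l)%R ->
  measurable_fun A v -> (forall x, A x -> (0 <= v x)%R) -> measurable_fun A f ->
  wint mu v q A f <= (l `^ q)%:E * \int[mu]_(x in A) (v x)%:E
    + (l `^ (q - p))%:E * wint mu v p A f.
Proof.
move=> mA q0 qp l0 mv v0 mf.
have mvE : measurable_fun A (EFin \o v) by exact/measurable_EFinP.
have t0 x : A x -> 0 <= (`|f x| `^ p * v x)%:E.
  by move=> Ax; rewrite lee_fin mulr_ge0 ?powR_ge0 ?v0.
rewrite -!ge0_integralZl_EFin//; try exact: powR_ge0; last exact: measurable_wint.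
rewrite -ge0_integralD//; last 4 first.
- by move=> x Ax; rewrite lee_fin mulr_ge0 ?powR_ge0 ?v0.
- by apply: emeasurable_funM.
- by move=> x Ax; rewrite mule_ge0 ?t0// lee_fin powR_ge0.
- by apply: emeasurable_funM => //; exact: measurable_wint.
apply: le_lower_integral => x Ax; first by rewrite lee_fin mulr_ge0 ?powR_ge0 ?v0.
by rewrite -!EFinM -EFinD lee_fin mulrA -mulrDl ler_wpM2r ?v0// powR_interpolation.
Qed.

(** The parameter of the interpolation inequality is first taken so small that [l^q] times
the weight of [A] is below [eps / 2]; the other term is then controlled by the [L^p] integral. *)
Lemma wint_small p q A (eps : R) : measurable A -> (0 < q)%R -> (q <= p)%R ->
  measurable_fun A v -> (forall x, A x -> (0 <= v x)%R) ->
  \int[mu]_(x in A) (v x)%:E < +oo -> (0 < eps)%R ->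
  exists2 dl : R, (0 < dl)%R & forall f, measurable_fun A f ->
    wint mu v p A f <= dl%:E -> wint mu v q A f <= eps%:E.
Proof.
move=> mA q0 qp mv v0 vfin e0.
have vge0 : 0 <= \int[mu]_(x in A) (v x)%:E.
  by apply: integral_ge0 => x Ax; rewrite lee_fin v0.
have [V vE] : exists V : R, \int[mu]_(x in A) (v x)%:E = V%:E.
  exists (fine (\int[mu]_(x in A) (v x)%:E)); rewrite fineK// ge0_fin_numE//.
have V0 : (0 <= V)%R by rewrite -lee_fin -vE.
have a0 : (0 < eps / (2 * (V + 1)))%R by rewrite divr_gt0// mulr_gt0// ltr_wpDl.
pose l := ((eps / (2 * (V + 1))) `^ q^-1)%R.
have l0 : (0 < l)%R by rewrite powR_gt0.
exists (eps / 2 / l `^ (q - p))%R; first by rewrite !divr_gt0// powR_gt0.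
move=> f mf fp; apply: le_trans (wint_interpolation mA q0 qp l0 mv v0 mf) _.
have -> : eps = (eps / 2 + eps / 2)%R by rewrite -splitr.
rewrite EFinD leeD//.
  rewrite vE -EFinM lee_fin -powRrM mulVf ?gt_eqF// powRr1 ?(ltW a0)//.
  rewrite mulrAC ler_pdivrMr ?mulr_gt0 ?ltr_wpDl//.
  have -> : (eps / 2 * (2 * (V + 1)) = eps * (V + 1))%R by field.
  by rewrite ler_pM2l// lerDl.
have lp0 : (0 < l `^ (q - p))%R by rewrite powR_gt0.
by rewrite -lee_pdivlMl// -EFinM mulrC.
Qed.

End Weighted.

(** * Completeness of weighted spaces *)

Lemma cvg_of_geometric_increments (R : realType) (u : R^nat) (c z : R) :
  0 <= c -> 0 <= z -> z < 1 ->
  (forall k, `|u k.+1 - u k| <= c * z ^+ k) -> cvgn u.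
Proof.
move=> c0 z0 z1 uz.
have sc : cvgn (series (telescope u)).
  apply: normed_cvg; apply: (@series_le_cvg _ _ (geometric c z)) => [k|k|k|].
  - exact: normr_ge0.
  - by rewrite /= mulr_ge0// exprn_ge0.
  - exact: uz.
  - by apply: is_cvg_geometric_series; rewrite ger0_norm.
have -> : u = (fun k => u 0%N + series (telescope u) k).
  by apply/funext => k; rewrite -eq_sum_telescope.
by apply: is_cvgD => //; exact: is_cvg_cst.
Qed.

Lemma limn_einf_le_const (R : realType) (u : (\bar R)^nat) (c : \bar R) :
  (forall k, (u k <= c)%E) -> (limn_einf u <= c)%E.
Proof.
move=> uc; rewrite limn_einf_lim; apply: lime_le; first exact: is_cvg_einfs.
apply: nearW => k; apply: le_trans (uc k); apply: ereal_inf_lbound.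
by exists k => /=.
Qed.

Section Completeness.
Context d (T : measurableType d) (R : realType).
Variables (mu : {measure set T -> \bar R}) (v : T -> R) (A : set T) (q : R).
Hypotheses (mA : measurable A) (q0 : 0 < q).
Hypotheses (mv : measurable_fun A v) (v0 : forall x, A x -> 0 <= v x).
Variable u : nat -> T -> R.
Hypothesis mu_ : forall k, measurable_fun A (u k).
Hypothesis u_cauchy : forall i j, (i <= j)%N ->
  (wint mu v q A (fun x => u i x - u j x)%R <= ((4^-1) ^+ i)%:E)%E.
Local Open Scope ereal_scope.

(** The Riesz-Fischer argument. The function [sum_k 2^k |u_k - u_(k+1)|^q v] has a finite
integral, hence is finite almost everywhere; where it is finite and [v > 0], the increments decay
geometrically and [u_k] converges. Where [v = 0] the values of the limit do not matter. Fatou's lemma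
then bounds the distance of [u_k] to the limit by its distance to the later terms. *)
Lemma wint_complete : exists2 y : T -> R, measurable_fun A y &
  wint mu v q A (fun x => u k x - y x)%R @[k --> \oo] --> 0.
Proof.
pose g k x := ((2 ^+ k)%:E * (`|u k x - u k.+1 x| `^ q * v x)%:E).
have mgap i j : measurable_fun A (fun x => (`|u i x - u j x| `^ q * v x)%:E).
  by apply: measurable_wint => //; exact: measurable_funB.
have gap0 i j x : A x -> 0 <= (`|u i x - u j x| `^ q * v x)%:E.
  by move=> Ax; rewrite lee_fin mulr_ge0 ?powR_ge0 ?v0.
have g0 k x : A x -> 0 <= g k x.
  by move=> Ax; rewrite mule_ge0 ?gap0// lee_fin exprn_ge0.
have mg k : measurable_fun A (g k) by exact: emeasurable_funM.
pose F x := \sum_(k <oo) g k x.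
have F0 x : A x -> 0 <= F x by move=> Ax; apply: nneseries_ge0 => k _ _; exact: g0.
have mF : measurable_fun A F.
  by apply: ge0_emeasurable_sum => // k x Ax _; exact: g0.
have intF : \int[mu]_(x in A) F x < +oo.
  rewrite integral_nneseries//.
  apply: (@le_lt_trans _ _ (\sum_(k <oo) (2 / (2 ^ k.+1)%:R)%:E)); last first.
    by apply: le_lt_trans (epsilon_trick0 xpredT _) _; rewrite ?ltry.
  apply: lee_nneseries => [k _ _|k _]; first by apply: integral_ge0 => x; exact: g0.
  rewrite /g ge0_integralZl_EFin//; last by move=> x; exact: gap0.
  apply: (@le_trans _ _ ((2 ^+ k)%:E * ((4^-1) ^+ k)%:E)).
    by rewrite lee_wpmul2l ?lee_fin ?exprn_ge0//; exact: u_cauchy.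
  rewrite -EFinM lee_fin -exprMn natrX exprS invfM mulrA divff// mul1r -exprVn.
  by rewrite (_ : 2 * 4^-1 = 2^-1 :> R)%R//; field.
have [N [mN muN AN]] : {ae mu, forall x, A x -> F x \is a fin_num}.
  apply: integrable_ae => //; apply/integrableP; split => //.
  apply: le_lt_trans intF; apply: le_lower_integral => x Ax //.
  by rewrite gee0_abs// F0.
have conv x : (A `\` N) x -> (0 < v x)%R -> cvgn (u ^~ x).
  move=> [Ax Nx] vx.
  have Fx : F x \is a fin_num.
    by apply: contrapT => Fx; apply: Nx; apply: AN => /(_ Ax).
  pose c := (fine (F x) / v x)%R.
  have c0 : (0 <= c)%R by rewrite divr_ge0 ?fine_ge0 ?F0// ltW.
  have gap k : (`|u k x - u k.+1 x| `^ q <= c * (2^-1) ^+ k)%R.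
    have : g k x <= F x.
      rewrite /F (nneseries_split 0 k.+1)//; last by move=> *; exact: g0.
      rewrite add0n big_nat_recr//= -addeA; apply: le_trans (leeDr _ _); last first.
        by apply: sume_ge0 => i _; exact: g0.
      by rewrite leeDl//; apply: nneseries_ge0 => i _ _; exact: g0.
    rewrite -(fineK Fx) /g -EFinM lee_fin => gF.
    rewrite exprVn /c -mulrA -invfM ler_pdivlMr ?mulr_gt0 ?exprn_gt0//.
    by rewrite [leLHS](_ : _ = 2 ^+ k * (`|u k x - u k.+1 x| `^ q * v x))%R//; ring.
  apply: (@cvg_of_geometric_increments _ _ (c `^ q^-1)%R ((2^-1) `^ q^-1)%R).
  - exact: powR_ge0.
  - exact: powR_ge0.
  - have q1 : (0 < q^-1)%R by rewrite invr_gt0.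
    have := @gt0_ltr_powR R _ q1 2^-1%R 1%R; rewrite !nnegrE powR1; apply => //.
    by rewrite invf_lt1// ltr1n.
  - move=> k; rewrite -powR_mulrn ?powR_ge0// powRAC powR_mulrn// -powRM ?exprn_ge0//.
    have := @ge0_ler_powR _ q^-1 _ _ _ _ _ (gap k).
    rewrite -powRrM divff ?gt_eqF// powRr1// distrC; apply.
    + by rewrite invr_ge0 ltW.
    + by rewrite nnegrE powR_ge0.
    + by rewrite nnegrE mulr_ge0// exprn_ge0.
(* An upper limit is measurable on all of [A], including where [u_k] diverges. *)
pose y x := fine (limn_esup (fun k => (u k x)%:E)).
have my : measurable_fun A y.
  apply: measurableT_comp => //; apply: measurable_fun_limn_esup => k.
  exact/measurable_EFinP.
have uy x : (A `\` N) x -> (0 < v x)%R -> u k x @[k --> \oo] --> y x.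
  move=> ANx vx; have cu := conv _ ANx vx.
  have cuE : (u k x)%:E @[k --> \oo] --> (limn (u ^~ x))%:E.
    by apply: cvg_EFin => //; exact: nearW.
  by rewrite /y is_cvg_limn_esupE ?(cvg_lim _ cuE)//; exact: cvgP cuE.
exists y => //.
have bound k : wint mu v q A (fun x => u k x - y x)%R <= ((4^-1) ^+ k)%:E.
  have mAN : measurable (A `\` N) by exact: measurableD.
  rewrite /wint (ge0_negligible_integral mN)//; last 2 first.
  - by apply: measurable_wint => //; exact: measurable_funB.
  - by move=> x Ax; rewrite lee_fin mulr_ge0 ?powR_ge0 ?v0.
  pose f j x := (`|u k x - u (k + j)%N x| `^ q * v x)%:E.
  have mf j : measurable_fun (A `\` N) (f j) by apply: measurable_funS (mgap _ _).
  have f0 j x : (A `\` N) x -> 0 <= f j x by move=> [Ax _]; exact: gap0.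
  apply: (@le_trans _ _ (\int[mu]_(x in A `\` N) limn_einf (f ^~ x))).
    apply: le_lower_integral => x ANx; have Ax := ANx.1.
      by rewrite lee_fin mulr_ge0 ?powR_ge0 ?v0.
    suff fx : f j x @[j --> \oo] --> (`|u k x - y x| `^ q * v x)%:E.
      by rewrite is_cvg_limn_einfE; [rewrite (cvg_lim _ fx)|exact: cvgP fx].
    suff : (`|u k x - u (k + j)%N x| `^ q * v x)%R @[j --> \oo] -->
           (`|u k x - y x| `^ q * v x)%R by move=> ?; apply: cvg_EFin => //; exact: nearW.
    have := v0 Ax; rewrite le_eqVlt => /predU1P[<-|vx].
      by rewrite mulr0; under eq_fun do rewrite mulr0; exact: cvg_cst.
    apply: cvgMl; apply: cvg_powR => //.
    apply: cvg_norm; apply: cvgB; first exact: cvg_cst.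
    under eq_fun do rewrite addnC.
    by have := uy _ ANx vx; rewrite -(cvg_shiftn k).
  apply: le_trans (fatou _ mAN mf f0) _; apply: limn_einf_le_const => j.
  apply: le_trans (u_cauchy (leq_addr j k)).
  apply: le_lower_integral_set => [x []//|x Ax]; exact: gap0.
apply: (@squeeze_cvge _ _ _ _ (cst 0) _ (fun k => ((4^-1) ^+ k)%:E)).
- by apply: nearW => k; rewrite bound andbT wint_ge0.
- exact: cvg_cst.
- apply: cvg_EFin; first exact: nearW.
  by apply: cvg_expr; rewrite ger0_norm//; lra.
Qed.
End Completeness.

(** * Extraction of subsequences along an ultrafilter, and bounded overlap *)

Lemma free_ultrafilter : exists2 U : set_system nat, UltraFilter U & \oo `<=` U.
Proof. by have [U [UU FU]] := @ultraFilterLemma nat \oo _; exists U. Qed.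

(** A cluster point along an ultrafilter is a limit: a neighbourhood whose preimage is
not in [U] would be disjoint from a set of the image filter. *)
Lemma ultra_bounded_cvg (R : realType) (U : set_system nat) (a : nat -> R) (C : R) :
  UltraFilter U -> (forall i, `|a i| <= C) -> exists l : R, a i @[i --> U] --> l.
Proof.
move=> UU aC.
have : compact `[- C, C]%classic by exact: segment_compact.
move=> /(_ (a @ U) _)[|l [_ al]].
  suff : U [set i | a i \in `[- C, C]] by [].
  by apply: filterS filterT => i _ /=; rewrite in_itv/= -ler_norml; exact: aC.
exists l => B lB; have [//|aBC] := in_ultra_setVsetC (a @^-1` B) UU.
have [x [? /= ?]] : (~` B) `&` B !=set0 by exact: al.
by [].
Qed.

(** Countably many conditions, each of them satisfied on a set of [U], are satisfied from
some rank on by one subsequence. This plays the role of a diagonal extraction. *)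
Lemma ultra_subsequence (U : set_system nat) (V : nat -> set nat) :
  ProperFilter U -> \oo `<=` U -> (forall m, U (V m)) ->
  exists2 s : nat -> nat, increasing_seq s &
    forall m i, (m <= i)%N -> V m (s i).
Proof.
move=> PU ooU UV.
(* Decreasing sets of [U]: the indices are chosen in them one after the other. *)
pose W m := \bigcap_(l in [set l | (l <= m)%N]) V l.
have UW m : U (W m).
  elim: m => [|m IH].
    by apply: filterS (UV 0%N) => x Vx l /=; rewrite leqn0 => /eqP ->.
  apply: filterS (filterI IH (UV m.+1)) => x [Wx Vx] l /=.
  by rewrite leq_eqVlt => /predU1P[->//|]; rewrite ltnS; exact: Wx.
have next m b : exists n, (b < n)%N /\ W m n.
  have Ub : U [set n | (b < n)%N] by apply: ooU; exists b.+1.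
  by have [n [? ?]] := filter_ex (filterI Ub (UW m)); exists n.
have /choice[f fP] : forall mb : nat * nat, exists n, (mb.2 < n)%N /\ W mb.1 n.
  by move=> [m b]; exact: next.
pose s := fix s k := if k is k'.+1 then f (k, s k') else f (0%N, 0%N).
exists s.
  by apply/increasing_seqP => k /=; have [] := fP (k.+1, s k).
have sW k : W k (s k) by case: k => [|k]; [have [] := fP (0%N, 0%N)|have [] := fP (k.+1, s k)].
by move=> m i mi; apply: (sW i).
Qed.

Section UltraCauchy.
Context d (T : measurableType d) (R : realType).
Variables (U : set_system nat) (mu : {measure set T -> \bar R}) (v : T -> R).

(** For an ultrafilter [U], every sequence with values in a totally bounded set has this
property. It is stable under finite combinations and needs no choice of subsequence. *)
Definition ultra_cauchy (p : R) (A : set T) (u : nat -> T -> R) :=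
  forall eps : R, 0 < eps -> exists2 V, U V &
    forall i j, V i -> V j -> (wint mu v p A (fun x => u i x - u j x)%R <= eps%:E)%E.

Lemma ultra_cauchy_cvg (p : R) (A : set T) (u : nat -> T -> R) :
  ProperFilter U -> \oo `<=` U ->
  measurable A -> 0 < p -> measurable_fun A v -> (forall x, A x -> 0 <= v x) ->
  (forall k, measurable_fun A (u k)) -> ultra_cauchy p A u ->
  exists2 s : nat -> nat, increasing_seq s &
  exists2 y : T -> R, measurable_fun A y &
    wint mu v p A (fun x => u (s k) x - y x)%R @[k --> \oo] --> 0%E.
Proof.
move=> PU ooU mA p0 mv v0 mu_ uC.
have /choice[V VP] m : exists V, U V /\ forall i j, V i -> V j ->
    (wint mu v p A (fun x => u i x - u j x)%R <= ((4^-1) ^+ m)%:E)%E.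
  by have [|V UV VP] := uC (4^-1 ^+ m); [rewrite exprn_gt0|exists V].
have [s s_inc sV] := ultra_subsequence PU ooU (fun m => (VP m).1).
exists s => //; apply: (@wint_complete _ _ _ mu v A p) => // i j ij.
by apply: (VP i).2; exact: sV.
Qed.

End UltraCauchy.

Section Overlap.
Context d (T : measurableType d) (R : realType).
Variables (mu : {measure set T -> \bar R}).
Local Open Scope ereal_scope.

(** By superadditivity, the sum is at most the integral of [f] times the sum of the
indicators of the sets [B l]. *)
Lemma overlap_integral_le (m : nat) (B : 'I_m -> set T) (D : set T)
    (f : T -> \bar R) (N : R) : (0 < N)%R ->
  (forall l, B l `<=` D) -> (forall x, D x -> 0 <= f x) ->
  (forall x, D x -> (\sum_(l < m) \1_(B l) x <= N)%R) ->
  \sum_(l < m) \int[mu]_(x in B l) f x <= N%:E * \int[mu]_(x in D) f x.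
Proof.
move=> N0 BD f0 BN.
under eq_bigr do rewrite integral_mkcond.
have fB0 l x : 0 <= (f \_ (B l)) x by apply: erestrict_ge0 => y /BD; exact: f0.
apply: (@le_trans _ _ (\int[mu]_x \sum_(l < m) (f \_ (B l)) x)).
  exact: lower_integral_sum_ge.
rewrite [in leRHS]integral_mkcond.
have fD0 x : 0 <= (f \_ D) x by apply: erestrict_ge0 => y; exact: f0.
apply: le_trans (lower_integralZ_le mu N0 (fun x _ => fD0 x)).
apply: le_lower_integral => x _; first exact: sume_ge0.
have [Dx|Dx] := boolP (x \in D); last first.
  rewrite big1 ?mule_ge0 ?lee_fin ?(ltW N0)// => l _; rewrite patchE ifN//.
  by apply: contra Dx; rewrite !inE => /BD.
have fx0 := f0 _ (set_mem Dx).
rewrite [in leRHS]/patch Dx; apply: (@le_trans _ _ ((\sum_(l < m) \1_(B l) x)%:E * f x)).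
  rewrite -sumEFin ge0_sume_distrl; last by move=> *; rewrite lee_fin.
  apply: lee_sum => l _; rewrite /patch indicE.
  by case: ifP => _; rewrite ?mul1e ?mul0e.
by rewrite lee_wpmul2r// lee_fin BN//; exact: set_mem.
Qed.

End Overlap.

(** * Compact sets and locally Lipschitz functions in Euclidean space *)

Section EuclideanTopology.
Variables (R : realType) (n : nat).
Implicit Types (A Omega : set 'cV[R]_n).

Lemma trmx_rV_continuous : continuous (fun w : 'rV[R]_n => w^T).
Proof.
move=> w B /nbhs_ballP[e e0 eB]; apply/nbhs_ballP; exists e => // w' ww'.
by case: ww' => _ ww'; apply: eB; split => // i j; rewrite !mxE; exact: ww'.
Qed.

(** The Heine-Borel theorem for column vectors, transported from row vectors by
transposition. *)
Lemma cV_bounded_closed_compact A : bounded_set A -> closed A -> compact A.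
Proof.
move=> [M [Mreal bA]] cA.
have -> : A = trmx @` [set w : 'rV[R]_n | A w^T].
  apply/seteqP; split => [x Ax|_ [w Aw <-]//].
  by exists x^T; rewrite /= ?trmxK.
apply: continuous_compact.
  by apply: continuous_subspaceT; exact: trmx_rV_continuous.
apply: bounded_closed_compact.
  exists M; split => // m Mm w /= Aw; have := bA _ Mm _ Aw.
  apply: le_trans; rewrite !/Num.norm/= !mx_normrE.
  apply: bigmax_le; first by apply: bigmax_ge_id.
  move=> [i j] _ /=; apply: le_trans (le_bigmax _ _ (j, i)) => /=.
  by rewrite mxE.
by apply: preimage_closed cA => w _; exact: trmx_rV_continuous.
Qed.

(** The [k]-th set consists of the points at distance at least [1 / (k + 1)] from the
complement of [Omega]. *)
Lemma compact_exhaustion Omega : bounded_set Omega -> open Omega ->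
  exists K : nat -> set 'cV[R]_n, [/\ forall k, compact (K k),
    forall k, K k `<=` Omega, nondecreasing_seq K & \bigcup_k K k = Omega].
Proof.
move=> [M [Mreal bO]] oO.
pose K k : set 'cV[R]_n := [set x | forall y, ~ Omega y -> k.+1%:R^-1 <= `|x - y|].
have KO k : K k `<=` Omega.
  move=> x Kx; apply: contrapT => /Kx.
  by rewrite subrr normr0 leNgt invr_gt0 ltr0n.
exists K; split => //.
- move=> k; apply: cV_bounded_closed_compact.
    by exists M; split => // m Mm x /KO; exact: bO.
  have -> : K k = \bigcap_(y in ~` Omega) [set x | k.+1%:R^-1 <= `|x - y|].
    by apply/seteqP; split.
  apply: closed_bigI => y _.
  have cy : continuous (fun x : 'cV[R]_n => `|x - y|).
    move=> x B /nbhs_ballP[e /= e0 eB]; apply/nbhs_ballP; exists e => // z.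
    rewrite -ball_normE /= => xz; apply: eB; rewrite -ball_normE /=.
    by apply: le_lt_trans (ler_dist_dist _ _) _; rewrite opprB addrA subrK.
  apply: (@preimage_closed _ _ (fun x : 'cV[R]_n => `|x - y|) [set r : R | k.+1%:R^-1 <= r]).
    by move=> x _; exact: cy.
  exact: closed_ge.
- move=> k k' kk'; apply/subsetPset => x Kx y /Kx; apply: le_trans.
  by rewrite lef_pV2 ?posrE ?ltr0n// ler_nat.
- apply/seteqP; split => [x [k _ /KO]//|x Ox].
  have /nbhs_ballP[e /= e0 eO] : nbhs x Omega by exact: open_nbhs_nbhs.
  have [k _ /(_ k (leqnn k)) ke] := near_infty_natSinv_lt (PosNum e0).
  exists k => // y Oy; rewrite leNgt; apply/negP => xy; apply: Oy; apply: eO.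
  rewrite -ball_normE /=; exact: lt_trans ke.
Qed.

Lemma loc_lipschitz_continuous Omega (f : 'cV[R]_n -> R) x :
  loc_lipschitz Omega f -> Omega x -> {for x, continuous f}.
Proof.
move=> lf Ox; have [W xW [M [Mreal fM]]] := lf _ Ox.
pose k := Num.max (M + 1) 1.
have k0 : 0 < k by rewrite lt_max ltr01 orbT.
have {}fM : forall z, W z -> `|f x - f z| <= k * `|x - z|.
  have : M < k by rewrite lt_max ltrDl ltr01.
  move=> /fM fk z Wz; apply: (fk (x, z)); split => //=; exact: nbhs_singleton.
move=> B /nbhs_ballP[e /= e0 eB].
have : nbhs x (W `&` ball x (e / k)).
  by apply: filterI => //; apply: nbhsx_ballx; rewrite divr_gt0.
apply: filterS => z [Wz]; rewrite -ball_normE /= => xz; apply: eB.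
rewrite -ball_normE /=; apply: le_lt_trans (fM _ Wz) _.
by rewrite mulrC -ltr_pdivlMr.
Qed.

Lemma loc_lipschitz_measurable Omega (M : set (set 'cV[R]_n)) (f : 'cV[R]_n -> R) :
  borel_sigma_algebra_ext M -> open Omega -> loc_lipschitz Omega f ->
  mu_measurable M Omega f.
Proof.
move=> [_ oM] oO lf.
have oI (D : set 'cV[R]_n) : open D -> measurable (D : set (g_sigma_algebraType M)).
  by move=> /oM; exact: sub_sigma_algebra.
apply: (measurability _ (RGenOInfty.measurableE R)) => _ [_ [a ->] <-].
apply: oI; rewrite openE => x [Ox fx]; rewrite /interior.
apply: filterI; first exact: open_nbhs_nbhs.
apply: (loc_lipschitz_continuous lf Ox); move: fx => /=.
rewrite in_itv/= andbT => afx; apply: open_nbhs_nbhs; split => //=.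
by rewrite in_itv/= andbT.
Qed.

End EuclideanTopology.

(** * Nets in a quasimetric space *)

(** Greedy selection: a point is kept when it is close to none of the points already
kept. *)
Lemma separated_subseq (X : eqType) (close : rel X) (c : seq X) :
  exists c' : seq X, [/\ {subset c' <= c}, pairwise (fun x y => ~~ close x y) c' &
    forall y, y \in c -> exists2 x, x \in c' & (y == x) || close y x].
Proof.
elim: c => [|y c [c' [sc' pc' nc']]]; first by exists [::].
have [/hasP[x xc' yx]|/hasPn yc'] := boolP (has (close y) c').
  exists c'; split => // [z /sc'|z]; first by rewrite inE orbC => ->.
  by rewrite inE => /predU1P[->|/nc' //]; exists x => //; rewrite yx orbT.
exists (y :: c'); split => [z||z].
- by rewrite !inE => /predU1P[->|/sc' ->]; rewrite ?eqxx ?orbT.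
- by rewrite /= pc' andbT; apply/allP.
- rewrite inE => /predU1P[->|/nc' [x xc' yx]]; first by exists y; rewrite ?inE eqxx.
  by exists x => //; rewrite inE xc' orbT.
Qed.

Section Nets.
Variables (R : realType) (n : nat) (Omega : set 'cV[R]_n).
Variables (rho : 'cV[R]_n -> 'cV[R]_n -> R) (kappa : R).
Hypothesis kappa1 : 1 <= kappa.
Hypothesis rhoP : forall x y z, Omega x -> Omega y -> Omega z ->
  [/\ 0 <= rho x y, rho x y = 0 <-> x = y, rho x y = rho y x &
      rho x y <= kappa * (rho x z + rho z y)].

Let kappa0 : 0 < kappa. Proof. exact: lt_le_trans kappa1. Qed.

Lemma rho_triangle_lt x y z a b : Omega x -> Omega y -> Omega z ->
  rho x z < a -> rho z y < b -> rho x y < kappa * (a + b).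
Proof.
move=> Ox Oy Oz xz zy; have [_ _ _ /le_lt_trans] := rhoP Ox Oy Oz; apply.
by rewrite ltr_pM2l// ltrD.
Qed.

(** The net is selected from the centres of a finite cover of [K] by balls of radius [r]. A
discarded centre is within [r] of the net, and the radius [kappa * (r + r)] absorbs this loss. *)
Lemma quasimetric_net (K : set 'cV[R]_n) r : qballs_open Omega rho ->
  compact K -> K `<=` Omega -> 0 < r ->
  exists m (x : 'I_m -> 'cV[R]_n), [/\ forall l, K (x l),
    forall l l', l != l' -> r <= rho (x l) (x l') &
    K `<=` \bigcup_l qball Omega rho (x l) (kappa * (r + r))].
Proof.
move=> rho_open cK KO r0.
have rho0 x : Omega x -> rho x x = 0 by move=> Ox; have [_ /iffRL->] := rhoP Ox Ox Ox.
have rhoC x y : Omega x -> Omega y -> rho x y = rho y x.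
  by move=> Ox Oy; have [] := rhoP Ox Oy Ox.
move: cK; rewrite compact_cover => /(_ _ K (fun x => qball Omega rho x r)).
case=> [x /KO Ox|x Kx|D DK KD].
- exact: rho_open.
- by exists x => //; split; [exact: KO|rewrite rho0//; exact: KO].
have [c [cD cpair ccover]] := separated_subseq (fun x y => rho x y < r) (finmap.enum_fset D).
have cK x : x \in c -> K x by move=> /cD /DK /set_mem.
exists (size c), (fun l => nth 0 c l); split.
- by move=> l; apply: cK; rewrite mem_nth.
- have sep (l l' : 'I_(size c)) : (l < l')%N -> r <= rho (nth 0 c l) (nth 0 c l').
    move: cpair => /(pairwiseP 0) /(_ l l'); rewrite !inE !ltn_ord => /(_ isT isT).
    by rewrite leNgt => H ll'; exact: H.
  move=> l l'; rewrite -(inj_eq val_inj) neq_ltn => /orP[/sep//|/sep].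
  by rewrite rhoC//; apply/KO/cK/mem_nth.
- move=> z Kz; have [y /= yD [Oz yz]] := KD _ Kz.
  have [x xc yx] := ccover _ yD.
  have [Ox Oy] : Omega x /\ Omega y by split; apply: KO; [exact: cK|exact/set_mem/DK].
  have xc' : (index x c < size c)%N by rewrite index_mem.
  exists (Ordinal xc') => //=; rewrite nth_index//; split => //.
  apply: (@rho_triangle_lt x z y r r) => //.
  by move: yx => /predU1P[->|]; rewrite ?rho0// rhoC.
Qed.

(** The centres of the balls of radius [a * r] that contain [y] lie within
[kappa * (a * r + a * r)] of any one of them, whereas the balls of radius [r / (2 * kappa)] around
them are disjoint. The ratio of these two radii involves only [a] and [kappa], so that the doubling
condition gives a bound which is uniform in [r] and in the net. *)
Lemma net_overlap (K : set 'cV[R]_n) (delta r a N : R) (m : nat) (x : 'I_m -> 'cV[R]_n) :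
  K `<=` Omega -> 0 < r -> 1 <= a -> kappa * (a * r + a * r) < delta -> 0 <= N ->
  (forall s r' y, 0 < s -> s <= r' -> r' < delta -> K y ->
    forall (m : nat) (c : 'I_m -> 'cV[R]_n),
    (forall i, qball Omega rho y r' (c i)) ->
    trivIset setT (fun i => qball Omega rho (c i) s) ->
    r' / s = kappa * (a + a) * (2 * kappa) -> m%:R <= N) ->
  (forall l, K (x l)) -> (forall l l', l != l' -> r <= rho (x l) (x l')) ->
  forall y, Omega y -> \sum_(l < m) \1_(qball Omega rho (x l) (a * r)) y <= N.
Proof.
move=> KO r0 a1 ard N0 doubling Kx xsep y Oy.
have rhoC z w : Omega z -> Omega w -> rho z w = rho w z.
  by move=> Oz Ow; have [] := rhoP Oz Ow Oz.
pose I := [set l : 'I_m | y \in qball Omega rho (x l) (a * r)]%SET.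
have -> : \sum_(l < m) \1_(qball Omega rho (x l) (a * r)) y = #|I|%:R :> R.
  rewrite -sum1_card natr_sum [RHS]big_mkcond/=; apply: eq_bigr => l _.
  by rewrite indicE inE; case: (_ \in _).
have [I0|[l0]] := set_0Vmem I; first by rewrite I0 cards0.
rewrite inE => /set_mem[_ yl0].
have kr : r / (2 * kappa) * (2 * kappa) = r by rewrite divfK// gt_eqF// mulr_gt0.
have s0 : 0 < r / (2 * kappa) by rewrite divr_gt0// mulr_gt0.
apply: (doubling (r / (2 * kappa)) (kappa * (a * r + a * r)) (x l0) _ _ _ _ _
  (fun k => x (enum_val k))) => //.
- rewrite ler_pdivrMr ?mulr_gt0//.
  have : r <= a * r by rewrite ler_peMl// ltW.
  have : 1 <= kappa * kappa by rewrite mulr_ege1.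
  nra.
- move=> k; split; first exact/KO/Kx.
  have := enum_valP k; rewrite inE => /set_mem[_ yk].
  apply: (@rho_triangle_lt _ _ y) => //; [exact/KO/Kx|exact/KO/Kx|].
  by rewrite rhoC//; exact/KO/Kx.
- apply/trivIsetP => i j _ _ ij; apply/seteqP; split => // z [[Oz iz] [_ jz]].
  have := xsep (enum_val i) (enum_val j); rewrite (inj_eq enum_val_inj) => /(_ ij).
  apply/negP; rewrite -ltNge.
  have Oi := KO _ (Kx (enum_val i)); have Oj := KO _ (Kx (enum_val j)).
  have := rho_triangle_lt Oi Oj Oz iz; rewrite (rhoC z (x _))// => /(_ _ jz).
  suff -> : kappa * (r / (2 * kappa) + r / (2 * kappa)) = r by [].
  by rewrite -[RHS]kr; ring.
- by rewrite -mulrDl mulrA invfM invrK; field; rewrite ?gt_eqF.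
Qed.

End Nets.

(** * Averages over the sets of a finite cover *)

Section ExtendedPowers.
Variable R : realType.
Local Open Scope ereal_scope.

Lemma le_of_poweRV_le (a : \bar R) (c p : R) : (0 < p)%R -> 0 <= a ->
  a `^ p^-1 <= c%:E -> a <= (c `^ p)%:E.
Proof.
move=> p0 a0 ac.
have := @gt0_ler_poweR _ p (ltW p0) (a `^ p^-1) c%:E.
rewrite !in_itv/= !leey !andbT poweR_ge0 => /(_ isT (le_trans (poweR_ge0 _ _) ac) ac).
by rewrite -poweRrM mulVf ?gt_eqF// poweRe1.
Qed.

Lemma poweRV_add_le (a b : \bar R) (p : R) : (0 < p)%R -> 0 <= a -> 0 <= b ->
  (a `^ p^-1 + b `^ p^-1) `^ p <= (2 `^ p)%:E * (a + b).
Proof.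
move=> p0; have cy : (0 < (2 `^ p)%:E :> \bar R) by rewrite lte_fin powR_gt0.
case: a => [a||]// a0; last first.
  by move=> b0; rewrite addye ?gt0_muley ?leey// -ltNye (lt_le_trans _ b0).
case: b => [b||]// b0; last by rewrite addey// gt0_muley ?leey.
rewrite !poweR_EFin -EFinD -EFinM lee_fin.
apply: le_trans (powRD_le (ltW p0) _ _) _; rewrite ?powR_ge0//.
by rewrite -!powRrM mulVf ?gt_eqF// !powRr1.
Qed.

End ExtendedPowers.

Section CoverAverages.
Context d (T : measurableType d) (R : realType).
Variables (mu : {measure set T -> \bar R}) (v : T -> R).
Local Open Scope ereal_scope.

Lemma wint_cover_le (p : R) (m : nat) (B : 'I_m -> set T) (K D : set T) (f : T -> R) :
  (forall l, measurable (B l)) -> (forall l, B l `<=` D) -> K `<=` \bigcup_l B l ->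
  measurable_fun D v -> (forall x, D x -> (0 <= v x)%R) -> measurable D ->
  measurable_fun D f ->
  wint mu v p K f <= \sum_(l < m) wint mu v p (B l) f.
Proof.
move=> mB BD KB mv v0 mD mf.
pose F x := (`|f x| `^ p * v x)%:E.
have mF : measurable_fun D F by exact: measurable_wint.
have F0 x : D x -> 0 <= F x by move=> Dx; rewrite lee_fin mulr_ge0 ?powR_ge0 ?v0.
rewrite /wint integral_mkcond; under eq_bigr do rewrite integral_mkcond.
have FB0 l x : 0 <= (F \_ (B l)) x by apply: erestrict_ge0 => y /BD; exact: F0.
rewrite -ge0_integral_sum//; last first.
  by move=> l; apply/(measurable_restrictT _ (mB l)); exact: measurable_funS mF.
apply: le_lower_integral => x _.
  by apply: erestrict_ge0 => y /KB[l _ /BD]; exact: F0.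
rewrite [leLHS]/patch; case: ifPn => [/set_mem/KB[l _ Bx]|_]; last exact: sume_ge0.
rewrite (bigD1 l)//= patchE mem_set// leeDl// sume_ge0// => i _; exact: FB0.
Qed.

(** The formula of [wavg], over an arbitrary measurable space. *)
Definition weighted_average (B : set T) (f : T -> R) : R :=
  ((\int[mu]_(x in B) v x)^-1 * \int[mu]_(x in B) (f x * v x))%R.

(** Because [fine] sends infinite values to [0], whose inverse is [0]. *)
Lemma weighted_average_infinite (B : set T) (f : T -> R) :
  \int[mu]_(x in B) (v x)%:E \isn't a fin_num -> weighted_average B f = 0%R.
Proof.
rewrite /weighted_average {1}/Rintegral => vBy.
rewrite (_ : fine _ = 0%R) ?invr0 ?mul0r//.
by move: vBy; case: (\int[mu]_(x in B) (v x)%:E).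
Qed.

(** Since [|f| <= 1 + |f|^p], the integral of [|f| v] is bounded by the weight of [B]
plus [C]. *)
Lemma weighted_average_bounded (p : R) (B : set T) (u : nat -> T -> R) (C : R) :
  (1 <= p)%R -> measurable B -> measurable_fun B v -> (forall x, B x -> (0 <= v x)%R) ->
  (forall i, measurable_fun B (u i)) -> (forall i, wint mu v p B (u i) <= C%:E) ->
  exists M : R, forall i, (`|weighted_average B (u i)| <= M)%R.
Proof.
move=> p1 mB mv v0 mu_ uC.
pose V := (\int[mu]_(x in B) v x)%R.
have vB0 : 0 <= \int[mu]_(x in B) (v x)%:E.
  by apply: integral_ge0 => x Bx; rewrite lee_fin v0.
have V0 : (0 <= V)%R by rewrite fine_ge0.
have [VE|vBy] := boolP (\int[mu]_(x in B) (v x)%:E \is a fin_num); last first.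
  by exists 0%R => i; rewrite weighted_average_infinite// normr0.
exists (V^-1 * (V + C))%R => i; rewrite normrM (ger0_norm (_ : 0 <= V^-1)%R) ?invr_ge0//.
rewrite ler_wpM2l ?invr_ge0//.
have mvE : measurable_fun B (EFin \o v) by exact/measurable_EFinP.
have mw := measurable_wint p mv (mu_ i).
have w0 x : B x -> 0 <= (`|u i x| `^ p * v x)%:E.
  by move=> Bx; rewrite lee_fin mulr_ge0 ?powR_ge0 ?v0.
have le1 : `|\int[mu]_(x in B) (u i x * v x)%:E| <= (V + C)%:E.
  apply: le_trans (le_abse_integral _ mB _) _.
    by apply/measurable_EFinP; exact: measurable_funM.
  apply: (@le_trans _ _ (\int[mu]_(x in B) ((v x)%:E + (`|u i x| `^ p * v x)%:E))).
    apply: le_lower_integral => x Bx //; rewrite -EFinD abse_EFin lee_fin normrM.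
    rewrite (ger0_norm (v0 _ Bx)) -{2}[v x]mul1r -mulrDl ler_wpM2r ?v0//.
    have [u1|u1] := leP (`|u i x|)%R 1%R; first by rewrite (le_trans u1)// lerDl powR_ge0.
    by apply: le_trans (le1r_powR (ltW u1) p1) _; rewrite lerDr.
  rewrite ge0_integralD//.
  by rewrite EFinD leeD//; [rewrite fineK|exact: uC].
have fI : \int[mu]_(x in B) (u i x * v x)%:E \is a fin_num.
  by rewrite -abse_fin_num ge0_fin_numE// (le_lt_trans le1) ?ltry.
by rewrite /Rintegral -lee_fin -abse_EFin fineK.
Qed.

(** The averages form a bounded sequence of reals, which converges along [U], and
constants are integrated against a finite weight. If the weight of [B] is infinite, all averages
vanish. *)
Lemma weighted_average_ultra (U : set_system nat) (p : R) (B : set T)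
    (u : nat -> T -> R) (C : R) : UltraFilter U ->
  (1 <= p)%R -> measurable B -> measurable_fun B v -> (forall x, B x -> (0 <= v x)%R) ->
  (forall i, measurable_fun B (u i)) -> (forall i, wint mu v p B (u i) <= C%:E) ->
  ultra_cauchy U mu v p B (fun i _ => weighted_average B (u i)).
Proof.
move=> UU p1 mB mv v0 mu_ uC t t0.
have p0 : (0 < p)%R by exact: lt_le_trans p1.
have [M aM] := weighted_average_bounded p1 mB mv v0 mu_ uC.
have [l al] := ultra_bounded_cvg UU aM.
have vB0 : 0 <= \int[mu]_(x in B) (v x)%:E.
  by apply: integral_ge0 => x Bx; rewrite lee_fin v0.
have [VE|vBy] := boolP (\int[mu]_(x in B) (v x)%:E \is a fin_num); last first.
  exists setT; first exact: filterT.
  move=> i j _ _; rewrite /wint integral0_eq ?lee_fin ?ltW// => x Bx.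
  by rewrite !weighted_average_infinite// subrr normr0 powR0 ?gt_eqF// mul0r.
pose V := fine (\int[mu]_(x in B) (v x)%:E).
have V0 : (0 <= V)%R by rewrite fine_ge0.
pose s := ((t / (V + 1)) `^ p^-1)%R.
have tV0 : (0 < t / (V + 1))%R by rewrite divr_gt0// ltr_wpDl.
have s0 : (0 < s / 2)%R by rewrite divr_gt0// powR_gt0.
exists [set i | `|l - weighted_average B (u i)| < s / 2]%R.
  by move/cvgrPdist_lt : al => /(_ _ s0).
move=> i j /= il jl; rewrite /wint; set c := (_ - _)%R.
have cs : (`|c| <= s)%R.
  rewrite /c [s]splitr -(subrKA l) (le_trans (ler_normD _ _))// lerD ?ltW//.
  by rewrite distrC.
under eq_integral do rewrite EFinM.
rewrite ge0_integralZl_EFin ?powR_ge0//; last exact/measurable_EFinP.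
rewrite -(fineK VE) -/V -EFinM lee_fin.
apply: (@le_trans _ _ (t / (V + 1) * V)%R); last first.
  by rewrite mulrAC ler_pdivrMr ?ltr_wpDl// ler_pM2l// lerDl.
apply: ler_wpM2r => //.
have -> : (t / (V + 1) = s `^ p)%R by rewrite -powRrM mulVf ?gt_eqF// powRr1// ltW.
by apply: ge0_ler_powR; rewrite ?nnegrE ?powR_ge0// ltW.
Qed.

End CoverAverages.

(** * Bounded sequences of Lipschitz functions *)

(** Used to compare two functions through their averages on a ball, and two elements of
the completion through their Lipschitz approximants. *)
Lemma wint_four_points d (T : measurableType d) (R : realType)
    (mu : {measure set T -> \bar R}) (v : T -> R) (p : R) (A : set T) (f g f' g' : T -> R) :
  measurable A -> 0 <= p -> measurable_fun A v -> (forall x, A x -> 0 <= v x) ->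
  measurable_fun A f -> measurable_fun A g ->
  measurable_fun A f' -> measurable_fun A g' ->
  (wint mu v p A (fun x => f x - g x)%R <=
    (2 `^ p)%:E * ((2 `^ p)%:E * (wint mu v p A (fun x => f x - f' x)%R +
                                 wint mu v p A (fun x => g x - g' x)%R) +
                  wint mu v p A (fun x => f' x - g' x)%R))%E.
Proof.
move=> mA p0 mv v0 mf mg mf' mg'.
rewrite (eq_wint mu v p (g := fun x => (f x - f' x - (g x - g' x)) + (f' x - g' x))); last first.
  by move=> x _; ring.
have mfg := measurable_funB mf mf'; have mgg := measurable_funB mg mg'.
apply: le_trans (wintD_le mu mA p0 mv v0 _ _) _.
- exact: measurable_funB.
- exact: measurable_funB.
rewrite lee_wpmul2l ?lee_fin ?powR_ge0//; apply: leeD2r.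
rewrite -(wintN _ _ _ _ (fun x => g x - g' x)).
by apply: (wintD_le mu mA p0 mv v0) => //; exact: measurableT_comp.
Qed.

(** The two constraints on the radius of a net: the Poincare inequality must hold on the
balls of the cover, and doubling must apply at the scale of the enlarged balls. *)
Lemma small_radius (R : realFieldType) (kappa a d1 d2 : R) :
  0 < kappa -> 1 <= a -> 0 < d1 -> 0 < d2 ->
  exists r : R, [/\ 0 < r, kappa * (r + r) < d1 & kappa * (a * r + a * r) < d2].
Proof.
move=> k0 a1 d10 d20; have a0 : 0 < a by exact: lt_le_trans a1.
have den0 : 0 < 4 * kappa * a by rewrite !mulr_gt0.
have [r r0 [rd1 rd2]] : exists2 r : R, 0 < r &
    r * (4 * kappa * a) <= d1 /\ r * (4 * kappa * a) <= d2.
  exists (Num.min d1 d2 / (4 * kappa * a)); first by rewrite divr_gt0// lt_min d10.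
  by rewrite divfK ?gt_eqF// !ge_min !lexx orbT.
have kr0 : 0 < kappa * r by rewrite mulr_gt0.
exists r; split => //; [apply: lt_le_trans rd1|apply: lt_le_trans rd2]; rewrite -subr_gt0.
- have -> : r * (4 * kappa * a) - kappa * (r + r) = kappa * r * (4 * a - 2) by ring.
  by rewrite mulr_gt0//; lra.
- have -> : r * (4 * kappa * a) - kappa * (a * r + a * r) = kappa * r * (2 * a) by ring.
  by rewrite !mulr_gt0.
Qed.

Section Energy.
Variables (R : realType) (n : nat) (M : set (set 'cV[R]_n)).
Notation T := (g_sigma_algebraType M).
Variables (mu : {measure set T -> \bar R}) (Omega : set 'cV[R]_n).
Variables (p : R) (v : 'cV[R]_n -> R) (Q : 'cV[R]_n -> 'M[R]_n).
Hypothesis p1 : 1 < p.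
Let p0 : 0 < p. Proof. exact: lt_trans p1. Qed.

(** The [p]-th power of [LnormQ]. *)
Definition qint (A : set 'cV[R]_n) (w : 'cV[R]_n -> 'cV[R]_n) : \bar R :=
  (\int[mu]_(x in A) (enorm (sqrtmx (Q x) *m w x) `^ p)%:E)%E.

Lemma qint_ge0 A w : (0 <= qint A w)%E.
Proof. by apply: integral_ge0 => x _; rewrite lee_fin powR_ge0. Qed.

Lemma QHnorm_energy_le A z C : (forall x, A x -> 0 <= v x) ->
  (QHnorm mu p v Q A z <= C%:E)%E ->
  (wint mu v p A z.1 <= (C `^ p)%:E)%E /\ (qint A z.2 <= (C `^ p)%:E)%E.
Proof.
move=> v0 zC; split; apply: le_of_poweRV_le => //.
- exact: wint_ge0.
- by apply: le_trans zC; rewrite leeDl// poweR_ge0.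
- exact: qint_ge0.
- by apply: le_trans zC; rewrite leeDr// poweR_ge0.
Qed.

(** The Poincare inequality in a form that can be summed over balls: the [p]-th powers
on the right-hand side are superadditive in [B']. *)
Lemma poincare_energy_le (B B' : set 'cV[R]_n) (z : ('cV[R]_n -> R) * ('cV[R]_n -> 'cV[R]_n))
    (f : 'cV[R]_n -> R) (eta : R) : 0 <= eta ->
  (forall x, B x -> 0 <= v x) -> (forall x, B' x -> 0 <= v x) ->
  (Lnormw mu p v B f <= eta%:E * QHnorm mu p v Q B' z)%E ->
  (wint mu v p B f <= (eta `^ p * 2 `^ p)%:E * (wint mu v p B' z.1 + qint B' z.2))%E.
Proof.
move=> eta0 v0 v0' H.
have Hp := @gt0_ler_poweR _ p (ltW p0) _ _ _ _ H; move: Hp.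
rewrite !in_itv/= !leey !andbT poweR_ge0 => /(_ isT).
have e0 : (0 <= eta%:E * QHnorm mu p v Q B' z)%E.
  by rewrite mule_ge0 ?lee_fin// adde_ge0// poweR_ge0.
move=> /(_ e0); rewrite -poweRrM mulVf ?gt_eqF// poweRe1; last exact: wint_ge0.
move=> /le_trans; apply; rewrite poweRM ?lee_fin//; last by rewrite adde_ge0// poweR_ge0.
rewrite poweR_EFin EFinM -muleA lee_wpmul2l ?lee_fin ?powR_ge0//.
by apply: poweRV_add_le => //; [exact: wint_ge0|exact: qint_ge0].
Qed.

Hypotheses (hM : borel_sigma_algebra_ext M) (oO : open Omega).
Hypotheses (mv : mu_measurable M Omega v) (v0 : forall x, Omega x -> 0 <= v x).

Lemma open_measurable_ext (D : set 'cV[R]_n) : open D -> measurable (D : set T).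
Proof. by case: hM => _ oM /oM; exact: sub_sigma_algebra. Qed.

Lemma compact_measurable_ext (K : set 'cV[R]_n) : compact K -> measurable (K : set T).
Proof.
move=> cK; rewrite -[K]setCK; apply: measurableC; apply: open_measurable_ext.
by apply: closed_openC; exact: compact_closed.
Qed.

Variables (rho : 'cV[R]_n -> 'cV[R]_n -> R).
Hypothesis rho_quasimetric : is_quasimetric Omega rho.
Hypothesis rho_open : qballs_open Omega rho.
Hypothesis rho_doubling : locally_geometrically_doubling Omega rho.
Hypothesis poincare : local_poincare mu Omega p v Q rho.

(** The heart of the proof. On each ball of the cover, [f_i - f_j] is split into the
two oscillations [f_i - a_i] and [f_j - a_j], which the Poincare inequality makes small after
summation, and the constant [a_i - a_j], which is small for [i] and [j] in a set of [U]. *)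
Lemma lipschitz_ultra_cauchy (U : set_system nat) (f : nat -> 'cV[R]_n -> R) (C : R)
    (K : set 'cV[R]_n) : UltraFilter U ->
  (forall i, loc_lipschitz Omega (f i)) -> 0 <= C ->
  (forall i, wint mu v p Omega (f i) <= C%:E)%E ->
  (forall i, qint Omega (grad (f i)) <= C%:E)%E ->
  compact K -> K `<=` Omega -> ultra_cauchy U mu v p K f.
Proof.
move=> UU lipf C0 fC gC cK KO eps e0.
have [kappa k1 rhoP] := rho_quasimetric.
have [Cd Cd0 dbl] := rho_doubling.
have [c0 c01 poin] := poincare.
have k0 : 0 < kappa by exact: lt_le_trans k1.
have c00 : 0 < c0 by exact: lt_le_trans c01.
have [dd dd0 dblK] := dbl K cK KO.
pose a := c0 * (kappa * 2).
have a1 : 1 <= a by rewrite !mulr_ege1 ?ler1n.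
have a0 : 0 < a by exact: lt_le_trans a1.
(* The bound on the overlap; [a] and [N] are known before the radius is chosen. *)
pose N := Cd (kappa * (a + a) * (2 * kappa)).
have N0 : 0 < N by apply: Cd0; rewrite !mulr_gt0// addr_gt0.
pose c : R := 2 `^ p.
have cgt0 : 0 < c by rewrite powR_gt0.
pose th := eps / (4 * (c * c)).
have th0 : 0 < th by rewrite divr_gt0// !mulr_gt0.
pose D := c * (N * (2 * (C + 1))).
have D0 : 0 < D by rewrite /D !mulr_gt0// ltr_wpDl.
(* The constant of the Poincare inequality is such that [eta^p * D = th]. *)
pose eta := (th / D) `^ p^-1.
have eta0 : 0 < eta by rewrite powR_gt0// divr_gt0.
have [d1 d10 poinK] := poin K eta cK KO eta0.
have [r [r0 rd1 rdd]] : exists r : R,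
    [/\ 0 < r, kappa * (r + r) < d1 & kappa * (a * r + a * r) < dd].
  exact: small_radius.
have [m [x [xK xsep Kcov]]] := quasimetric_net k1 rhoP rho_open cK KO r0.
pose B l := qball Omega rho (x l) (kappa * (r + r)).
pose B' l := qball Omega rho (x l) (a * r).
have BO l : B l `<=` Omega by move=> y [].
have B'O l : B' l `<=` Omega by move=> y [].
have mO : measurable (Omega : set T) := open_measurable_ext oO.
have mB l : measurable (B l : set T).
  by apply: open_measurable_ext; apply: rho_open; exact/KO/xK.
have mf i : mu_measurable M Omega (f i) by exact: loc_lipschitz_measurable.
have mvB l : measurable_fun (B l : set T) v by exact: measurable_funS mv.
have mfB l i : measurable_fun (B l : set T) (f i) by exact: measurable_funS (mf i).
have v0B l y : B l y -> 0 <= v y by move=> /BO; exact: v0.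
pose av l i : R := weighted_average mu v (B l) (f i).
have overlap : forall y, Omega y -> \sum_(l < m) \1_(B' l) y <= N.
  apply: (net_overlap k1 rhoP KO r0 a1 rdd (ltW N0) _ xK xsep).
  move=> s r' y s0 sr' r'd Ky m' c' c'B c'triv ratio.
  by rewrite /N -ratio; exact: (dblK s r' y).
(* Total oscillation over the cover, bounded uniformly in [i]. *)
have S_le i : (\sum_(l < m) wint mu v p (B l) (fun y => f i y - av l i)%R <= th%:E)%E.
  apply: (@le_trans _ _ (\sum_(l < m) (eta `^ p * c)%:E *
      (wint mu v p (B' l) (f i) + qint (B' l) (grad (f i))))%E).
    apply: lee_sum => l _.
    apply: (@poincare_energy_le (B l) (B' l) (f i, grad (f i))) => //; first exact: ltW.
    - exact: v0B.
    - by move=> y /B'O; exact: v0.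
    - have := poinK (kappa * (r + r)) (x l) _ (xK l) _ (lipf i).
      rewrite mulr_gt0 ?addr_gt0// rd1 => /(_ isT) /=.
      by rewrite (_ : c0 * (kappa * (r + r)) = a * r)//; rewrite /a; ring.
  rewrite -ge0_sume_distrr; last first.
    move=> l _; rewrite adde_ge0 ?qint_ge0// wint_ge0// => y /B'O; exact: v0.
  rewrite big_split/=.
  apply: (@le_trans _ _ ((eta `^ p * c)%:E * (N%:E * C%:E + N%:E * C%:E))%E).
    apply: lee_wpmul2l; first by rewrite lee_fin mulr_ge0 ?powR_ge0// ltW.
    apply: leeD.
    - apply: le_trans (@overlap_integral_le _ T R mu m B' Omega _ N N0 B'O _ overlap) _.
        by move=> y Oy; rewrite lee_fin mulr_ge0 ?powR_ge0 ?v0.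
      by rewrite lee_pmul2l//; exact: fC.
    - apply: le_trans (@overlap_integral_le _ T R mu m B' Omega _ N N0 B'O _ overlap) _.
        by move=> y Oy; rewrite lee_fin powR_ge0.
      by rewrite lee_pmul2l//; exact: gC.
  rewrite -!EFinM lee_fin /eta -powRrM mulVf ?gt_eqF// powRr1; last first.
    by rewrite ltW// divr_gt0.
  have -> : th / D * c * (N * C + N * C) = th * ((c * (N * (2 * C))) / D).
    by rewrite mulrAC mulrA; ring.
  rewrite ler_piMr ?(ltW th0)// ler_pdivrMr// mul1r /D.
  by rewrite !ler_pM2l// lerDl.
(* An equal share of the error for the averages on each of the [m] balls. *)
pose t := eps / (2 * c) / (m%:R + 1).
have t0 : 0 < t by rewrite !divr_gt0// ?mulr_gt0// ltr_wpDl.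
have avU l := weighted_average_ultra UU (ltW p1) (mB l) (mvB l) (v0B l) (mfB l)
  (fun i => le_trans (wint_subset mu p (f i) v0 (BO l)) (fC i)) t0.
have /choice[V VP] l : exists V : set nat, U V /\ forall i j, V i -> V j ->
    (wint mu v p (B l) (fun _ => av l i - av l j)%R <= t%:E)%E.
  by have [V UV VP] := avU l; exists V.
exists [set i | forall l, V l i].
  exact: (@filter_forall _ _ V U _ (fun l => (VP l).1)).
move=> i j Vi Vj.
have mfij : measurable_fun (Omega : set T) (fun y => f i y - f j y).
  exact: (measurable_funB (mf i) (mf j)).
apply: le_trans (wint_cover_le mu p mB BO Kcov mv v0 mO mfij) _.
apply: (@le_trans _ _ (\sum_(l < m) (c%:E * (c%:E *
    (wint mu v p (B l) (fun y => f i y - av l i)%R +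
     wint mu v p (B l) (fun y => f j y - av l j)%R)
    + wint mu v p (B l) (fun=> av l i - av l j)%R)))%E).
  apply: lee_sum => l _.
  apply: (@wint_four_points _ T R mu v p (B l) (f i) (f j)
    (cst (av l i)) (cst (av l j))) => //; [exact: ltW|exact: v0B].
have w0 k h : (0 <= wint mu v p (B k) h)%E by exact/wint_ge0/v0B.
have cE0 : (0 <= c%:E)%E by rewrite lee_fin ltW.
rewrite -ge0_sume_distrr; last first.
  by move=> k _; apply: adde_ge0 => //; apply: mule_ge0 => //; exact: adde_ge0.
rewrite big_split/= -ge0_sume_distrr; last by move=> l _; rewrite adde_ge0.
rewrite big_split/=.
apply: (@le_trans _ _ (c%:E * (c%:E * (th%:E + th%:E) + (m%:R * t)%:E))%E).
  rewrite lee_wpmul2l// leeD// ?lee_wpmul2l// ?leeD//.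
  apply: (@le_trans _ _ (\sum_(l < m) t%:E)%E).
    by apply: lee_sum => l _; exact: (VP l).2.
  by rewrite sumEFin sumr_const card_ord -[X in (_ <= (X * _)%:E)%E]/(m%:R) mulr_natl.
rewrite -!EFinM lee_fin.
have -> : c * (c * (th + th) + m%:R * t) = eps / 2 + eps / 2 * (m%:R / (m%:R + 1)).
  by rewrite /th /t; field; rewrite ?gt_eqF// ltr_wpDl.
rewrite [leRHS]splitr lerD2l ler_piMr ?divr_ge0 ?(ltW e0)//.
by rewrite ler_pdivrMr ?ltr_wpDl// mul1r lerDl.
Qed.

End Energy.

(** * Passage to the completion *)

Lemma cvg0_eventually_lt (R : realType) (x : nat -> \bar R) (e : R) :
  x k @[k --> \oo] --> 0%E -> 0 < e -> \forall k \near \oo, (x k < e%:E)%E.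
Proof.
move=> /fine_cvgP[xfin /cvgrPdist_lt x0] e0; near=> k.
have xk : x k \is a fin_num by near: k.
rewrite -(fineK xk) lte_fin; apply: le_lt_trans (ler_norm _) _.
by rewrite -normrN -[- _]add0r; near: k; exact: x0.
Unshelve. all: by end_near. Qed.

Section EuclideanNorm.
Variables (R : realType) (n : nat).
Implicit Types (x y : 'cV[R]_n).

Lemma enorm_ge0 x : 0 <= enorm x. Proof. exact: sqrtr_ge0. Qed.

Lemma enormN x : enorm (- x) = enorm x.
Proof. by rewrite /enorm; under eq_bigr do rewrite mxE sqrrN. Qed.

Lemma enormD_le x y : enorm (x + y) <= 2 * Num.max (enorm x) (enorm y).
Proof.
have sq0 (z : 'cV[R]_n) : 0 <= \sum_i z i ord0 ^+ 2 by apply: sumr_ge0 => i _; exact: sqr_ge0.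
have m0 : 0 <= Num.max (enorm x) (enorm y) by rewrite le_max enorm_ge0.
have sqE (z : 'cV[R]_n) : \sum_i z i ord0 ^+ 2 = enorm z ^+ 2 by rewrite sqr_sqrtr.
rewrite -[leRHS]ger0_norm ?mulr_ge0// -sqrtr_sqr /enorm ler_wsqrtr//.
apply: (@le_trans _ _ (2 * (enorm x ^+ 2 + enorm y ^+ 2))).
  rewrite -!sqE -big_split mulr_sumr/=; apply: ler_sum => i _; rewrite mxE.
  by rewrite -subr_ge0 (_ : _ - _ = (x i ord0 - y i ord0) ^+ 2) ?sqr_ge0//; ring.
have -> (m : R) : (2 * m) ^+ 2 = 2 * (m ^+ 2 + m ^+ 2) by ring.
by rewrite ler_pM2l// lerD// lerXn2r ?nnegrE ?enorm_ge0// le_max lexx ?orbT.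
Qed.

Lemma powR_enormD_le x y p : 0 <= p ->
  enorm (x + y) `^ p <= 2 `^ p * (enorm x `^ p + enorm y `^ p).
Proof.
move=> p0; have m0 : 0 <= Num.max (enorm x) (enorm y) by rewrite le_max enorm_ge0.
apply: (@le_trans _ _ ((2 * Num.max (enorm x) (enorm y)) `^ p)).
  by apply: ge0_ler_powR; rewrite ?nnegrE ?enorm_ge0 ?mulr_ge0 ?enormD_le.
by rewrite powRM// ler_wpM2l ?powR_ge0// powR_max_le ?enorm_ge0.
Qed.

End EuclideanNorm.

Section QHspace.
Variables (R : realType) (n : nat) (M : set (set 'cV[R]_n)).
Notation T := (g_sigma_algebraType M).
Variables (mu : {measure set T -> \bar R}) (Omega : set 'cV[R]_n).
Variables (p : R) (v : 'cV[R]_n -> R) (Q : 'cV[R]_n -> 'M[R]_n).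
Hypothesis p1 : 1 < p.
Let p0 : 0 < p. Proof. exact: lt_trans p1. Qed.
Hypotheses (hM : borel_sigma_algebra_ext M) (oO : open Omega).
Hypotheses (mv : mu_measurable M Omega v) (v0 : forall x, Omega x -> 0 <= v x).
Hypothesis (mQ : mu_measurable_mx M Omega (fun x => sqrtmx (Q x))).

Let mO : measurable (Omega : set T). Proof. exact: open_measurable_ext. Qed.

Lemma measurable_qint (w : 'cV[R]_n -> 'cV[R]_n) : mu_measurable_vec M Omega w ->
  measurable_fun (Omega : set T) (fun x => (enorm (sqrtmx (Q x) *m w x) `^ p)%:E).
Proof.
move=> mw; apply/measurable_EFinP.
apply: (measurableT_comp (measurable_powR p)).
have -> : (fun x => enorm (sqrtmx (Q x) *m w x)) =
    (fun x => (\sum_i (\sum_j sqrtmx (Q x) i j * w x j ord0) ^+ 2) `^ 2^-1).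
  apply/funext => x; rewrite powR12_sqrt ?/enorm; last first.
    by apply: sumr_ge0 => i _; exact: sqr_ge0.
  by congr (Num.sqrt _); apply: eq_bigr => i _; rewrite mxE.
apply: (measurableT_comp (measurable_powR _)).
apply: measurable_sum => i; apply: measurable_funX; apply: measurable_sum => j.
by apply: measurable_funM; [exact: mQ|exact: mw].
Qed.

(** As [w'] is a gradient in the application, the measurable summand has to be the one that
comes from [w]. *)
Lemma qint_approx_le (w w' : 'cV[R]_n -> 'cV[R]_n) : mu_measurable_vec M Omega w ->
  (qint mu p Q Omega w' <=
   (2 `^ p)%:E * (qint mu p Q Omega w + qint mu p Q Omega (fun x => w x - w' x)%R))%E.
Proof.
move=> mw; have c0 : 0 < 2 `^ p :> R by rewrite powR_gt0.
have c0' : (0 <= (2 `^ p)%:E :> \bar R)%E by rewrite lee_fin powR_ge0.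
rewrite ge0_muleDr ?qint_ge0//.
apply: (@le_trans _ _ (qint mu p Q Omega w * (2 `^ p)%:E +
   \int[mu]_(x in Omega)
     ((2 `^ p)%:E * (enorm (sqrtmx (Q x) *m (w x - w' x)) `^ p)%:E)))%E; last first.
  rewrite muleC; apply: leeD2l; apply: lower_integralZ_le => // x _.
  by rewrite lee_fin powR_ge0.
rewrite muleC -ge0_integralZl_EFin ?powR_ge0//; last 2 first.
- by move=> x _; rewrite lee_fin powR_ge0.
- exact: measurable_qint.
apply: lower_integralD_le => //.
- by move=> x _; rewrite lee_fin powR_ge0.
- by move=> x _; rewrite lee_fin mulr_ge0 ?powR_ge0.
- by apply: emeasurable_funM => //; exact: measurable_qint.
- by move=> x _; rewrite lee_fin mulr_ge0 ?powR_ge0.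
- move=> x _; rewrite -!EFinM -EFinD lee_fin -mulrDr.
  have -> : sqrtmx (Q x) *m w' x = sqrtmx (Q x) *m w x + (- (sqrtmx (Q x) *m (w x - w' x))).
    by rewrite -mulmxBr opprB addrCA subrr addr0.
  by apply: le_trans (powR_enormD_le _ _ (ltW p0)) _; rewrite enormN.
Qed.

Variables (rho : 'cV[R]_n -> 'cV[R]_n -> R).
Hypothesis rho_quasimetric : is_quasimetric Omega rho.
Hypothesis rho_open : qballs_open Omega rho.
Hypothesis rho_doubling : locally_geometrically_doubling Omega rho.
Hypothesis poincare : local_poincare mu Omega p v Q rho.

(** Each [u_k] is replaced by a Lipschitz function at distance at most [t], where [t] does
not depend on [k]; the sequence of approximants is again bounded. *)
Lemma QH_ultra_cauchy (U : set_system nat)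
    (u : nat -> ('cV[R]_n -> R) * ('cV[R]_n -> 'cV[R]_n))
    (C : R) (K : set 'cV[R]_n) : UltraFilter U ->
  (forall k, QH mu Omega p v Q (u k)) ->
  (forall k, QHnorm mu p v Q Omega (u k) <= C%:E)%E ->
  compact K -> K `<=` Omega -> ultra_cauchy U mu v p K (fun k => (u k).1).
Proof.
move=> UU uQ uC cK KO eps e0.
pose c : R := 2 `^ p.
have c0 : 0 < c by rewrite powR_gt0.
(* The bound 1 keeps the approximants bounded, the other one controls the error. *)
pose t := Num.min 1 ((eps / (4 * (c * c))) `^ p^-1).
have e4 : 0 < eps / (4 * (c * c)) by rewrite divr_gt0// !mulr_gt0.
have t0 : 0 < t by rewrite lt_min ltr01 powR_gt0.
have tp1 : t `^ p <= 1.
  have -> : 1 = 1 `^ p :> R by rewrite powR1.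
  by apply: ge0_ler_powR; rewrite ?nnegrE ?(ltW p0) ?(ltW t0)// ge_min lexx.
have tpe : t `^ p <= eps / (4 * (c * c)).
  have -> : eps / (4 * (c * c)) = ((eps / (4 * (c * c))) `^ p^-1) `^ p.
    by rewrite -powRrM mulVf ?gt_eqF// powRr1// ltW.
  by apply: ge0_ler_powR; rewrite ?nnegrE ?powR_ge0 ?(ltW p0) ?(ltW t0)// ge_min lexx orbT.
have /choice[f fP] k : exists f, LipQ mu Omega p v Q f /\
    (QHnorm mu p v Q Omega (u k - (f, grad f))%R <= t%:E)%E.
  have [_ _ [f fL f0]] := uQ k.
  have : (\forall j \near \oo, QHnorm mu p v Q Omega (u k - (f j, grad (f j)))%R < t%:E)%E.
    exact: (cvg0_eventually_lt f0 t0).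
  by move=> /filter_ex[j fj]; exists (f j); split => //; exact: ltW.
have mu_ k : mu_measurable M Omega (u k).1 by have [[]] := uQ k.
have lipf k : loc_lipschitz Omega (f k) by have [[]] := fP k.
have mf k : mu_measurable M Omega (f k) by exact: loc_lipschitz_measurable.
have uE k := QHnorm_energy_le p1 v0 (uC k).
have dE k := QHnorm_energy_le p1 v0 (fP k).2.
pose C' := c * (C `^ p + 1).
have C'0 : 0 <= C' by rewrite mulr_ge0 ?addr_ge0 ?powR_ge0// ltW.
have fC k : (wint mu v p Omega (f k) <= C'%:E)%E.
  rewrite (eq_wint mu v p (g := fun x => (u k).1 x + (f k x - (u k).1 x))); last first.
    by move=> x _; rewrite addrC subrK.
  apply: le_trans (wintD_le mu mO (ltW p0) mv v0 (mu_ k) _) _.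
    exact: (measurable_funB (mf k) (mu_ k)).
  rewrite /C' EFinM lee_wpmul2l ?lee_fin ?(ltW c0)// EFinD leeD//; first exact: (uE k).1.
  by rewrite wintC; apply: le_trans (dE k).1 _; rewrite lee_fin.
have gC k : (qint mu p Q Omega (grad (f k)) <= C'%:E)%E.
  have mu2 : mu_measurable_vec M Omega (u k).2 by have [_ []] := uQ k.
  apply: le_trans (qint_approx_le _ mu2) _.
  rewrite /C' EFinM lee_wpmul2l ?lee_fin ?(ltW c0)// EFinD leeD//; first exact: (uE k).2.
  by apply: le_trans (dE k).2 _; rewrite lee_fin.
have [|V UV VP] := @lipschitz_ultra_cauchy _ _ _ mu Omega p v Q p1 hM oO mv v0 rho
  rho_quasimetric rho_open rho_doubling poincare U f C' K UU lipf C'0 fC gC cK KO (eps / (2 * c)).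
  by rewrite divr_gt0// mulr_gt0.
exists V => // i j Vi Vj.
have mK : measurable (K : set T) by exact: compact_measurable_ext.
have mvK : measurable_fun (K : set T) v by exact: measurable_funS mv.
have muK k : measurable_fun (K : set T) (u k).1 by exact: measurable_funS (mu_ k).
have mfK k : measurable_fun (K : set T) (f k) by exact: measurable_funS (mf k).
have v0K x : K x -> 0 <= v x by move=> /KO; exact: v0.
apply: le_trans (wint_four_points mu mK (ltW p0) mvK v0K (muK i) (muK j) (mfK i) (mfK j)) _.
have dK k : (wint mu v p K (fun x => (u k).1 x - f k x)%R <= (eps / (4 * (c * c)))%:E)%E.
  apply: le_trans (wint_subset mu p _ v0 KO) _.
  by apply: le_trans (dE k).1 _; rewrite lee_fin.
have cE0 : (0 <= c%:E)%E by rewrite lee_fin ltW.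
apply: (@le_trans _ _ (c%:E * (c%:E * ((eps / (4 * (c * c)))%:E + (eps / (4 * (c * c)))%:E)
   + (eps / (2 * c))%:E))%E).
  rewrite lee_wpmul2l// leeD ?VP// lee_wpmul2l// leeD//; exact: dK.
rewrite -!EFinM lee_fin le_eqVlt; apply/orP; left; apply/eqP.
by field; rewrite gt_eqF.
Qed.

End QHspace.

(** * Compact embeddings *)

Section Tails.
Context d (T : measurableType d) (R : realType).
Variables (mu : {measure set T -> \bar R}) (v : T -> R) (D : set T).
Hypotheses (mD : measurable D) (mv : measurable_fun D v) (v0 : forall x, D x -> 0 <= v x).
Local Open Scope ereal_scope.

(** Monotone convergence of the integrals over [K k]. *)
Lemma integral_exhaustion_tail (K : nat -> set T) (t : R) :
  (forall k, measurable (K k)) -> nondecreasing_seq K -> \bigcup_k K k = D ->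
  \int[mu]_(x in D) (v x)%:E < +oo -> (0 < t)%R ->
  exists k, \int[mu]_(x in D `\` K k) (v x)%:E <= t%:E.
Proof.
move=> mK ndK KD vfin t0.
have KsD k : K k `<=` D by rewrite -KD; exact: bigcup_sup.
have mvE : measurable_fun D (EFin \o v) by exact/measurable_EFinP.
have vE0 x : D x -> 0 <= (v x)%:E by move=> Dx; rewrite lee_fin v0.
pose g k := (EFin \o v) \_ (K k).
have mg k : measurable_fun D (g k).
  apply: measurable_funTS; apply/(measurable_restrictT _ (mK k)).
  exact: measurable_funS mvE.
have g0 k x : D x -> 0 <= g k x by move=> _; apply: erestrict_ge0 => y /KsD; exact: vE0.
have ndg x : D x -> nondecreasing_seq (g ^~ x).
  move=> Dx i j ij; rewrite /g /patch; case: ifPn => [/set_mem Kx|_].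
    by rewrite mem_set//; move/subsetPset: (ndK _ _ ij); apply.
  by case: ifPn => // _; exact: vE0.
have := @cvg_monotone_convergence _ _ _ mu D mD g mg g0 ndg.
have -> : \int[mu]_(x in D) limn (g ^~ x) = \int[mu]_(x in D) (v x)%:E.
  apply: eq_integral => x /set_mem Dx; apply/cvg_lim => //.
  have [k _ Kx] : (\bigcup_k K k) x by rewrite KD.
  apply: cvg_near_cst; exists k => // j /= kj; apply/eqP.
  by rewrite /g /patch mem_set//; move/subsetPset: (ndK _ _ kj); apply.
have vI : \int[mu]_(x in D) (v x)%:E \is a fin_num by rewrite ge0_fin_numE// integral_ge0.
have split k : \int[mu]_(x in D) (v x)%:E =
    \int[mu]_(x in D) g k x + \int[mu]_(x in D `\` K k) (v x)%:E.
  rewrite /g -integral_mkcondr (setIidr (KsD k)) -ge0_integral_setU//.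
  - by rewrite setDUK.
  - exact: measurableD.
  - by rewrite setDUK.
  - by rewrite setDUK.
  - by rewrite disj_set2E setDIK.
rewrite -(fineK vI) => /fine_cvgP[gfin /cvgrPdist_lt /(_ _ t0) gv].
have [k [gk dk]] := filter_ex (filterI gfin gv).
exists k; have := split k; rewrite -(fineK vI) -(fineK gk).
set a := fine _; set b := fine _ => ab.
have -> : \int[mu]_(x in D `\` K k) (v x)%:E = (a - b)%:E.
  by rewrite EFinB ab addeAC subee// add0e.
by rewrite lee_fin; apply: le_trans (ler_norm _) (ltW dk).
Qed.

(** Boundedness in [L^p] with [q < p] gives equi-integrability: the interpolation
inequality with a large [l] makes the [L^q] integral over [D `\` K k] small as soon as the weight of
that set is small, uniformly in [i] and [j]. On [K k] itself the hypothesis applies. *)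
Lemma ultra_cauchy_exhaustion (U : set_system nat) (p q C : R)
    (K : nat -> set T) (u : nat -> T -> R) : (0 < q)%R -> (q < p)%R ->
  (forall k, measurable (K k)) -> nondecreasing_seq K -> \bigcup_k K k = D ->
  \int[mu]_(x in D) (v x)%:E < +oo ->
  (forall i, measurable_fun D (u i)) ->
  (forall i, wint mu v p D (u i) <= C%:E) ->
  (forall k, ultra_cauchy U mu v p (K k) u) -> ultra_cauchy U mu v q D u.
Proof.
move=> q0 qp mK ndK KD vfin mu_ uC uK eps e0.
have p0 : (0 < p)%R by exact: lt_trans qp.
have KsD k : K k `<=` D by rewrite -KD; exact: bigcup_sup.
have C0 : (0 <= C)%R by rewrite -lee_fin; apply: le_trans (uC 0%N); exact: wint_ge0.
pose E := (2 `^ p * (C + C))%R.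
have E0 : (0 <= E)%R by rewrite mulr_ge0 ?powR_ge0// addr_ge0.
have muij i j : measurable_fun D (fun x => u i x - u j x)%R by exact: measurable_funB.
have uijE i j : wint mu v p D (fun x => u i x - u j x)%R <= E%:E.
  apply: le_trans (wintD_le mu mD (ltW p0) mv v0 (mu_ i) _) _; first exact: measurableT_comp.
  by rewrite /E EFinM lee_wpmul2l ?lee_fin ?powR_ge0// EFinD leeD// wintN.
have b0 : (0 < eps / (4 * (E + 1)))%R by rewrite divr_gt0// mulr_gt0// ltr_wpDl.
have qpne : (q - p != 0)%R by rewrite subr_eq0 lt_eqF.
(* As [q - p < 0], this [l] is large when [eps] is small. *)
pose l := ((eps / (4 * (E + 1))) `^ (q - p)^-1)%R.
have l0 : (0 < l)%R by rewrite powR_gt0.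
have lE : (l `^ (q - p) = eps / (4 * (E + 1)))%R by rewrite -powRrM mulVf// powRr1// ltW.
have lq0 : (0 < l `^ q)%R by rewrite powR_gt0.
have [|k Kk] := integral_exhaustion_tail mK ndK KD vfin (t := eps / 4 / l `^ q).
  by rewrite !divr_gt0.
have mvK : measurable_fun (K k) v by exact: measurable_funS mv.
have v0K x : K k x -> (0 <= v x)%R by move=> /KsD; exact: v0.
have vKfin : \int[mu]_(x in K k) (v x)%:E < +oo.
  apply: le_lt_trans vfin; apply: le_lower_integral_set (KsD k) _ => x Dx.
  by rewrite lee_fin v0.
have [|dl dl0 dlP] := wint_small (mK k) q0 (ltW qp) mvK v0K vKfin (eps := eps / 2).
  by rewrite divr_gt0.
have [V UV VP] := uK k dl dl0.
exists V => // i j Vi Vj.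
have mDK : measurable (D `\` K k) by exact: measurableD.
have DKD : D `\` K k `<=` D by move=> x [].
have -> : wint mu v q D (fun x => u i x - u j x)%R =
    wint mu v q (K k) (fun x => u i x - u j x)%R +
    wint mu v q (D `\` K k) (fun x => u i x - u j x)%R.
  rewrite /wint -ge0_integral_setU ?setDUK//.
  - exact: measurable_wint.
  - by move=> x Dx; rewrite lee_fin mulr_ge0 ?powR_ge0 ?v0.
  - by rewrite disj_set2E setDIK.
rewrite [eps]splitr EFinD leeD//.
  by apply: dlP; [exact: measurable_funS (muij i j)|exact: VP].
apply: le_trans (wint_interpolation mu mDK q0 (ltW qp) l0 _ _ _) _.
- exact: measurable_funS mv.
- by move=> x /DKD; exact: v0.
- exact: measurable_funS (muij i j).
have -> : (eps / 2 = eps / 4 + eps / 4)%R by field.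
rewrite EFinD leeD//.
  by rewrite -lee_pdivlMl// -EFinM mulrC.
rewrite lE; apply: (@le_trans _ _ ((eps / (4 * (E + 1)))%:E * E%:E)).
  rewrite lee_wpmul2l ?lee_fin ?(ltW b0)//.
  exact: le_trans (wint_subset mu p _ v0 DKD) (uijE i j).
rewrite -EFinM lee_fin mulrAC ler_pdivrMr ?mulr_gt0 ?ltr_wpDl//.
have -> : (eps / 4 * (4 * (E + 1)) = eps * (E + 1))%R by field.
by rewrite ler_pM2l// lerDl.
Qed.

End Tails.

Section Embedding.
Variables (R : realType) (n : nat) (M : set (set 'cV[R]_n)).
Notation T := (g_sigma_algebraType M).
Variables (mu : {measure set T -> \bar R}) (Omega : set 'cV[R]_n).
Variables (p q : R) (v : 'cV[R]_n -> R) (Q : 'cV[R]_n -> 'M[R]_n).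
Hypotheses (p1 : 1 < p) (q1 : 1 <= q) (qp : q <= p).
Hypotheses (mv : mu_measurable M Omega v) (v0 : forall x, Omega x -> 0 <= v x).
Hypothesis mO : measurable (Omega : set T).

Let p0 : 0 < p. Proof. exact: lt_trans p1. Qed.
Let q0 : 0 < q. Proof. exact: lt_le_trans q1. Qed.

Lemma Lnormw_lty A f : (Lnormw mu q v A f < +oo <-> wint mu v q A f < +oo)%E.
Proof.
split; last exact: poweR_lty.
by apply: lty_poweRy; rewrite invr_neq0// gt_eqF.
Qed.

(** Reduces a compact embedding to the Cauchy property along [U]; the two other
clauses follow from the interpolation inequality. The map [pi] is specified on [A] only, so that
restriction to [A] followed by extension by zero is covered. *)
Lemma compactly_embedded_ultra (U : set_system nat) (A : set 'cV[R]_n)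
    (pi : ('cV[R]_n -> R) * ('cV[R]_n -> 'cV[R]_n) -> ('cV[R]_n -> R)) :
  ProperFilter U -> \oo `<=` U ->
  measurable (A : set T) -> A `<=` Omega ->
  (\int[mu]_(x in A) (v x)%:E < +oo)%E ->
  (forall z x, A x -> pi z x = z.1 x) ->
  (forall u C, (forall k, QH mu Omega p v Q (u k)) ->
    (forall k, QHnorm mu p v Q Omega (u k) <= C%:E)%E ->
    ultra_cauchy U mu v q A (fun k => (u k).1)) ->
  compactly_embedded (QH mu Omega p v Q) (QHnorm mu p v Q Omega)
    (Lspacew mu q v A) (Lnormw mu q v A) pi.
Proof.
move=> PU ooU mA AO vA piE uC.
have mvA : measurable_fun (A : set T) v by exact: measurable_funS mv.
have v0A x : A x -> 0 <= v x by move=> /AO; exact: v0.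
have mpi z : QH mu Omega p v Q z -> measurable_fun (A : set T) (pi z).
  move=> [[mz _] _ _]; have mzA : measurable_fun (A : set T) z.1 by exact: measurable_funS mz.
  by apply: (@eq_measurable_fun _ _ T R A z.1 (pi z) _ mzA) => x /set_mem Ax; rewrite piE.
have finpi z : QH mu Omega p v Q z -> (wint mu v q A (pi z) < +oo)%E.
  move=> zQ; have [[mz zfin] _ _] := zQ.
  apply: le_lt_trans (wint_interpolation mu mA q0 qp ltr01 mvA v0A (mpi _ zQ)) _.
  rewrite !powR1 !mul1e lte_add_pinfty// (eq_wint mu v p (g := z.1)); last first.
    by move=> x Ax; rewrite piE.
  apply: le_lt_trans (wint_subset mu p _ v0 AO) _.
  by apply: lty_poweRy zfin; rewrite invr_neq0// gt_eqF.
split.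
- by move=> z zQ; split; [exact: mpi|apply/Lnormw_lty; exact: finpi].
- move=> [f w] [f' w'] zQ zQ' zz0.
  pose g : 'cV[R]_n -> R := fun x => (f : 'cV[R]_n -> R) x - (f' : 'cV[R]_n -> R) x.
  have gE x : A x -> (pi (f, w) - pi (f', w')) x = g x by move=> Ax; rewrite !fctE !piE.
  have g0 : (wint mu v p Omega g <= 0)%E.
    have : (QHnorm mu p v Q Omega ((f, w) - (f', w'))%R <= 0%:E)%E by rewrite zz0.
    by move=> /(QHnorm_energy_le p1 v0)[+ _]; rewrite powR0 ?gt_eqF.
  have mg : measurable_fun (A : set T) g.
    by apply: measurable_funS mO AO _; have [[mf _] _ _] := zQ; have [[mf' _] _ _] := zQ';
      exact: measurable_funB.
  suff w0 : wint mu v q A g = 0%E.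
    by rewrite /Lnormw -/(wint mu v q A _) (eq_wint mu v q gE) w0 poweR0r// invr_neq0// gt_eqF.
  apply/eqP; rewrite eq_le wint_ge0// andbT; apply/lee_addgt0Pr => e e0.
  rewrite add0e; have [dl dl0] := wint_small mA q0 qp mvA v0A vA e0.
  apply => //; apply: le_trans (wint_subset mu p _ v0 AO) _.
  by apply: le_trans g0 _; rewrite lee_fin ltW.
- move=> u uQ [C uB].
  have mu1 k : measurable_fun (A : set T) (u k).1.
    by have [[mz _] _ _] := uQ k; exact: measurable_funS mz.
  have [s s_inc [y my uy]] := ultra_cauchy_cvg PU ooU mA q0 mvA v0A mu1 (uC _ _ uQ uB).
  have wE k : wint mu v q A (pi (u (s k)) - y) = wint mu v q A (fun x => (u (s k)).1 x - y x).
    by apply: eq_wint => x Ax; rewrite fctE piE.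
  exists s => //; exists y.
    split => //; apply/Lnormw_lty.
    have [k yk] := filter_ex (cvg0_eventually_lt uy ltr01).
    rewrite (eq_wint mu v q (g := fun x => pi (u (s k)) x + (y x - pi (u (s k)) x))); last first.
      by move=> x _; rewrite addrC subrK.
    apply: le_lt_trans (wintD_le mu mA (ltW q0) mvA v0A (mpi _ (uQ _)) _) _.
      exact: (measurable_funB my (mpi _ (uQ _))).
    rewrite wintC lte_mul_pinfty ?lee_fin ?powR_ge0// lte_add_pinfty ?finpi//.
    by rewrite (wE k); exact: lt_trans yk (ltry _).
  rewrite /Lnormw; under eq_fun do rewrite -/(wint mu v q A (pi (u (s _)) - y)) wE.
  have /fine_cvgP[wfin w0] := uy.
  apply/fine_cvgP; split.
    by apply: filterS wfin => k; exact: fin_num_poweR.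
  rewrite /comp; under eq_fun do rewrite fine_poweR.
  rewrite (_ : 0 = 0 `^ q^-1); last by rewrite powR0// invr_neq0// gt_eqF.
  apply: cvg_powR w0; first by rewrite invr_gt0.
  by move=> k; rewrite fine_ge0// wint_ge0.
Qed.

End Embedding.

Theorem theorem1p6 (R : realType) (n : nat) (hn : (0 < n)%N)
  (p : R) (hp : 1 < p)
  (Omega : set 'cV[R]_n)
  (Omega_bounded : bounded_set Omega)
  (Omega_open : open Omega)
  (Omega_connected : connected Omega)
  (M : set (set 'cV[R]_n)) (hM : borel_sigma_algebra_ext M)
  (mu : {measure set (g_sigma_algebraType M) -> \bar R})
  (mu_regular : regular_measure mu Omega)
  (mu_ac : lebesgue_abs_continuous mu Omega)
  (Q : 'cV[R]_n -> 'M[R]_n)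
  (Q_measurable : mu_measurable_mx M Omega Q)
  (Q_psd : forall x, Omega x -> psdmx (Q x))
  (sqrtQ_Lp : Lp_matrix mu Omega p (fun x => sqrtmx (Q x)))
  (v : 'cV[R]_n -> R)
  (v_weight : is_weight mu Omega v)
  (v0_le_v : exists2 c2 : R, 0 < c2 &
     forall x, Omega x -> opnorm (Q x) `^ (p / 2) <= c2 * v x)
  (rho : 'cV[R]_n -> 'cV[R]_n -> R)
  (rho_quasimetric : is_quasimetric Omega rho)
  (rho_open : qballs_open Omega rho)
  (rho_interior : qballs_interior Omega rho)
  (rho_doubling : locally_geometrically_doubling Omega rho)
  (poincare : local_poincare mu Omega p v Q rho) :
  ((\int[mu]_(x in Omega) (v x)%:E < +oo)%E ->
   forall q : R, 1 <= q -> q < p ->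
     compactly_embedded
       (QH mu Omega p v Q) (QHnorm mu p v Q Omega)
       (Lspacew mu q v Omega) (Lnormw mu q v Omega)
       (fun z => z.1))
  /\
  (forall E : set 'cV[R]_n, M E -> compactly_contained Omega E ->
   forall q : R, 1 <= q -> q <= p ->
     compactly_embedded
       (QH mu Omega p v Q) (QHnorm mu p v Q Omega)
       (Lspacew mu q v E) (Lnormw mu q v E)
       (fun z => z.1 \_ E)).
Proof.
have [mv v0 vK] := v_weight.
have [msqrtQ _] := sqrtQ_Lp.
have p0 : 0 < p := lt_trans ltr01 hp.
have [U UU ooU] := free_ultrafilter.
have mO := open_measurable_ext hM Omega_open.
have UC u C K := @QH_ultra_cauchy R n M mu Omega p v Q hp hM Omega_open mv v0 msqrtQ rho
  rho_quasimetric rho_open rho_doubling poincare U u C K UU.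
split.
- move=> vfin q q1 qp; have q0 : 0 < q := lt_le_trans ltr01 q1.
  apply: (compactly_embedded_ultra hp q1 (ltW qp) mv v0 mO _ ooU) => // u C uQ uB.
  have [K [cK KO ndK KE]] := compact_exhaustion Omega_bounded Omega_open.
  have mK k := compact_measurable_ext hM (cK k).
  apply: (ultra_cauchy_exhaustion mO mv v0 q0 qp mK ndK KE vfin) => [i|i|k].
  + by have [[]] := uQ i.
  + exact: (QHnorm_energy_le hp v0 (uB i)).1.
  + exact: UC.
- move=> E mE [cE EO] q q1 qp; have q0 : 0 < q := lt_le_trans ltr01 q1.
  have mE' : measurable (E : set (g_sigma_algebraType M)) by exact: sub_sigma_algebra.
  have EcE : E `<=` closure E := @subset_closure _ E.
  have EOm : E `<=` Omega := subset_trans EcE EO.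
  have vE : (\int[mu]_(x in E) (v x)%:E < +oo)%E.
    apply: le_lt_trans (vK _ cE EO); apply: le_lower_integral_set => // x /EO Ox.
    by rewrite lee_fin v0.
  apply: (compactly_embedded_ultra hp q1 qp mv v0 mO _ ooU) => // [z x Ex|u C uQ uB eps e0].
    by rewrite patchE mem_set.
  have mvE : measurable_fun (E : set (g_sigma_algebraType M)) v by exact: measurable_funS mv.
  have v0E x : E x -> 0 <= v x by move=> /EOm; exact: v0.
  have [dl dl0 small] := wint_small mE' q0 qp mvE v0E vE e0.
  have [V UV VP] := UC u C _ uQ uB cE EO dl dl0.
  exists V => // i j Vi Vj; apply: small.
    apply: measurable_funS mO EOm _.
    by have [[mi _] _ _] := uQ i; have [[mj _] _ _] := uQ j; exact: measurable_funB.
  apply: le_trans (VP i j Vi Vj); apply: wint_subset => // x /EO; exact: v0.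
Qed.
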